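(* Let $\delta\in(0,n]$, $p\in[1,\infty)$, $q\in(0,\infty)$ and $w\in\mathcal A_{p,\delta}$. Then there exist positive constants $c$ and $C$ such that, for any cube $Q$, any $t\in(0,\infty)$, any $f\in \mathrm{BMO}^q_w(\mathbb R^n,\mathcal H_\infty^\delta)$ with $\|f\|_{\mathrm{BMO}^q_w(\mathbb R^n,\mathcal H_\infty^\delta)}\neq0$, and any $C_{f,w,Q}\in\Gamma_{f,w,Q}$, $$w_{\mathcal H_\infty^\delta}\left(\{x\in Q:|f(x)-C_{f,w,Q}|>t\}\right)\le C\,w_{\mathcal H_\infty^\delta}(Q)\,\exp\left(-\frac{ct}{\|f\|_{\mathrm{BMO}^q_w(\mathbb R^n,\mathcal H_\infty^\delta)}}\right).$$
   Context: A cube $Q\subset\mathbb R^n$ is always left-open and right-closed with sides parallel to the coordinate axes; $l(Q)$ is its edge length. For $\delta\in(0,n]$ and $E\subset\mathbb R^n$ the Hausdorff content is $\mathcal H_\infty^\delta(E)=\inf\{\sum_i l(Q_i)^\delta: E\subset\bigcup_iQ_i\}$, the infimum over all finite or countable coverings by cubes. The dyadic Hausdorff content is $\widetilde{\mathcal H}_\infty^\delta(E)=\inf\{\sum_i l(Q_i)^\delta: E\subset(\bigcup_iQ_i)^\circ\}$, the infimum over families of dyadic cubes of $\mathbb R^n$, $G^\circ$ denoting the interior of $G$. For $\mathcal K\in\{\mathcal H_\infty^\delta,\widetilde{\mathcal H}_\infty^\delta\}$ and any (not necessarily measurable) $f\ge0$, the Choquet integral is $\int_E f\,d\mathcal K=\int_0^\infty\mathcal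 K(\{x\in E:f(x)>t\})\,dt$. $L^1_{\rm loc}(\mathbb R^n,\mathcal H_\infty^\delta)$ is the set of functions with $\int_K|f|\,d\mathcal H_\infty^\delta<\infty$ for every compact $K$. A weight is a function $w\in L^1_{\rm loc}(\mathbb R^n,\mathcal H_\infty^\delta)$ with $w\in(0,\infty)$ $\mathcal H_\infty^\delta$-a.e. (i.e. outside a set of content zero). For $p\in(1,\infty)$, $\mathcal A_{p,\delta}$ is the set of weights with $[w]_{\mathcal A_{p,\delta}}=\sup_Q\{\frac1{\mathcal H_\infty^\delta(Q)}\int_Q w\,d\mathcal H_\infty^\delta\}\{\frac1{\mathcal H_\infty^\delta(Q)}\int_Q w^{-\frac1{p-1}}\,d\mathcal H_\infty^\delta\}^{p-1}<\infty$ (supremum over all cubes); $\mathcal A_{1,\delta}$ is the set of weights with $[w]_{\mathcal A_{1,\delta}}=\inf\{c\in(0,\infty):\mathcal M_{\mathcal H_\infty^\delta}w\le c\,w\ \ \mathcal H_\infty^\delta\text{-a.e.}\}<\infty$, where $\mathcal M_{\mathcal H_\infty^\delta}w(x)=\sup_{Q\ni x}\frac1{\mathcal H_\infty^\delta(Q)}\int_Q|w|\,d\mathcal H_\infty^\delta$. For a weight $w$ and a set $E$: $w_{\mathcal H_\infty^\delta}(E)=\int_E w\,d\mathcal H_\infty^\delta$ and $w_{\widetilde{\mathcal H}_\infty^\delta}(E)=\int_E w\,d\widetilde{\mathcal H}_\infty^\delta$. $L^q_{w,\rm loc}(\mathbb R^n,\mathcal H_\infty^\delta)$ is the set of functions with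 $\int_K|f|^qw\,d\mathcal H_\infty^\delta<\infty$ for every compact $K$. $\mathrm{BMO}^q_w(\mathbb R^n,\mathcal H_\infty^\delta)$ is the set of real-valued $f\in L^q_{w,\rm loc}(\mathbb R^n,\mathcal H_\infty^\delta)$ with $$\|f\|_{\mathrm{BMO}^q_w(\mathbb R^n,\mathcal H_\infty^\delta)}=\sup_Q\inf_{c\in\mathbb R}\left[\frac1{w_{\mathcal H_\infty^\delta}(Q)}\int_Q|f(x)-c|^qw(x)\,d\mathcal H_\infty^\delta\right]^{1/q}<\infty.$$ $\Gamma_{f,w,Q}$ (depending also on $q$) is the (nonempty) set of all real numbers $C_{f,w,Q}$ attaining $$\inf_{c\in\mathbb R}\frac1{w_{\widetilde{\mathcal H}_\infty^\delta}(Q)}\int_Q|f(x)-c|^qw(x)\,d\widetilde{\mathcal H}_\infty^\delta.$$ *)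

(* Defs.v *)
From mathcomp Require Import all_boot all_order all_algebra.
From mathcomp Require Import all_classical all_reals all_analysis.

Set Implicit Arguments.
Unset Strict Implicit.
Unset Printing Implicit Defensive.

Import Order.TTheory GRing.Theory Num.Theory.
Import numFieldNormedType.Exports.

Local Open Scope classical_set_scope.
Local Open Scope ring_scope.

Structure cube (R : realType) (n : nat) := Cube {
  corner : 'rV[R]_n ;
  edge : R ;
  edge_gt0 : 0 < edge }.

Definition cube_set (R : realType) (n : nat) (Q : cube R n) : set 'rV[R]_n :=
  [set x | forall i : 'I_n, corner Q 0 i < x 0 i <= corner Q 0 i + edge Q].

Coercion cube_set : cube >-> set.

Definition dyadic (R : realType) (n : nat) (Q : cube R n) : Prop :=
  exists (k : int) (m : 'I_n -> int),
    edge Q = 2 ^ k /\ forall i : 'I_n, corner Q 0 i = 2 ^ k * (m i)%:~R.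

Section choquet.
Local Open Scope ereal_scope.

(* A finite or countable family of cubes is a sequence Q restricted to an
   arbitrary index set D. *)
Definition hausdorff_content (R : realType) (n : nat) (delta : R)
    (E : set 'rV[R]_n) : \bar R :=
  ereal_inf [set s | exists (D : set nat) (Q : nat -> cube R n),
    E `<=` \bigcup_(i in D) (Q i : set _) /\
    s = \esum_(i in D) (edge (Q i) `^ delta)%:E].

Definition dyadic_content (R : realType) (n : nat) (delta : R)
    (E : set 'rV[R]_n) : \bar R :=
  ereal_inf [set s | exists (D : set nat) (Q : nat -> cube R n),
    [/\ forall i, D i -> dyadic (Q i),
        E `<=` (\bigcup_(i in D) (Q i : set _))° &
        s = \esum_(i in D) (edge (Q i) `^ delta)%:E]].

Definition choquet (R : realType) (T : Type) (K : set T -> \bar R)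
    (E : set T) (f : T -> \bar R) : \bar R :=
  \int[lebesgue_measure]_(t in `]0%R, +oo[) K [set x | E x /\ t%:E < f x].

(* Contents are not measures and are defined on all sets, so the library's
   measure-theoretic filter of almost everywhere properties does not apply. *)
Definition content_ae (R : realType) (T : Type) (K : set T -> \bar R)
    (P : T -> Prop) : Prop :=
  K [set x | ~ P x] = 0.

Definition loc_integrable (R : realType) (n : nat) (delta : R)
    (g : 'rV[R]_n -> \bar R) : Prop :=
  forall K : set 'rV[R]_n, compact K ->
    choquet (hausdorff_content delta) K (fun x => `|g x|) < +oo.

(* Weights are extended-valued: they are constrained to be positive and finite
   only outside a set of content zero, and no Choquet integral below depends on
   their values on such a set. *)
Definition is_weight (R : realType) (n : nat) (delta : R)
    (w : 'rV[R]_n -> \bar R) : Prop :=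
  loc_integrable delta w /\
  content_ae (hausdorff_content delta) (fun x => 0 < w x < +oo).

Definition choquet_mean (R : realType) (n : nat) (delta : R)
    (Q : cube R n) (g : 'rV[R]_n -> \bar R) : \bar R :=
  choquet (hausdorff_content delta) Q g / hausdorff_content delta Q.

(* The power w^(-1/(p-1)) is written (w^-1)^(1/(p-1)), because the library's
   powers of 0 and of +oo do not invert these values for negative exponents. *)
Definition Ap_const (R : realType) (n : nat) (delta p : R)
    (w : 'rV[R]_n -> \bar R) : \bar R :=
  ereal_sup (range (fun Q : cube R n =>
    choquet_mean delta Q w *
    choquet_mean delta Q (fun x => (w x)^-1 `^ (p - 1)^-1) `^ (p - 1))).

Definition maximal (R : realType) (n : nat) (delta : R)
    (w : 'rV[R]_n -> \bar R) (x : 'rV[R]_n) : \bar R :=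
  ereal_sup [set choquet_mean delta Q (fun y => `|w y|) |
             Q in [set Q : cube R n | (Q : set _) x]].

Definition A1_const (R : realType) (n : nat) (delta : R)
    (w : 'rV[R]_n -> \bar R) : \bar R :=
  ereal_inf [set c%:E | c in [set c : R | (0 < c)%R /\
    content_ae (hausdorff_content delta)
      (fun x => maximal delta w x <= c%:E * w x)]].

Definition A_class (R : realType) (n : nat) (p delta : R)
    (w : 'rV[R]_n -> \bar R) : Prop :=
  is_weight delta w /\
  (if p == 1%R then A1_const delta w else Ap_const delta p w) < +oo.

Definition weighted_power (R : realType) (n : nat) (q : R)
    (w : 'rV[R]_n -> \bar R) (f : 'rV[R]_n -> R) (x : 'rV[R]_n) : \bar R :=
  (`|f x| `^ q)%:E * w x.

Definition Lq_loc (R : realType) (n : nat) (delta q : R)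
    (w : 'rV[R]_n -> \bar R) (f : 'rV[R]_n -> R) : Prop :=
  forall K : set 'rV[R]_n, compact K ->
    choquet (hausdorff_content delta) K (weighted_power q w f) < +oo.

Definition oscillation (R : realType) (n : nat)
    (K : set 'rV[R]_n -> \bar R) (q : R) (w : 'rV[R]_n -> \bar R)
    (f : 'rV[R]_n -> R) (Q : cube R n) (c : R) : \bar R :=
  choquet K Q (weighted_power q w (fun x => f x - c)%R) / choquet K Q w.

Definition BMO_norm (R : realType) (n : nat) (delta q : R)
    (w : 'rV[R]_n -> \bar R) (f : 'rV[R]_n -> R) : \bar R :=
  ereal_sup (range (fun Q : cube R n =>
    ereal_inf (range (fun c : R =>
      oscillation (hausdorff_content delta) q w f Q c `^ q^-1)))).

Definition BMO (R : realType) (n : nat) (delta q : R)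
    (w : 'rV[R]_n -> \bar R) (f : 'rV[R]_n -> R) : Prop :=
  Lq_loc delta q w f /\ BMO_norm delta q w f < +oo.

Definition Gamma (R : realType) (n : nat) (delta q : R)
    (w : 'rV[R]_n -> \bar R) (f : 'rV[R]_n -> R) (Q : cube R n) : set R :=
  [set C | oscillation (dyadic_content delta) q w f Q C =
           ereal_inf (range (oscillation (dyadic_content delta) q w f Q))].

End choquet.

(* Main.v *)
Require Import Defs.
From HB Require Import structures.
From mathcomp Require Import all_boot all_order all_algebra.
From mathcomp Require Import all_classical all_reals all_analysis.
From mathcomp Require Import measurable_realfun ring lra zify.

Import Order.TTheory GRing.Theory Num.Theory.
Import numFieldNormedType.Exports.

Local Open Scope classical_set_scope.
Local Open Scope ring_scope.

(* A good-lambda iteration. Fix a cube Q with a center c, put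
   E = {x in Q : |f x - c| > lam}, and stop at the maximal dyadic subcubes R of
   Q in which the dyadic content of E relative to Q is at least
   theta l(R)^delta. On a cube that is not stopped this content is the sum of
   the contents of the children, so the stopped cubes satisfy a Carleson packing
   condition, and then the content of every set, hence w, is additive over them
   up to a constant. What E leaves outside the stopped cubes is a set Z whose
   content h satisfies h Z <= theta h Z, so it is null. A weight in A_p satisfies
   w(R) <= C w(E n R) as soon as E fills a fixed proportion of the content of R,
   and the parent of R is not stopped, which keeps the centers of Q and R within
   2 lam of each other. So each step of length 2 lam halves the weighted content
   of the deviation sets as soon as w(E) <= eta w(Q), which Chebyshev's
   inequality ensures for lam a large multiple of the BMO norm. The contents of
   all cubes are proportional to l^delta; if the constant vanishes, so does the
   left-hand side. *)

Set Implicit Arguments.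
Unset Strict Implicit.
Unset Printing Implicit Defensive.

(** * Choquet integrals *)

Section choquet_theory.
Local Open Scope ereal_scope.
Variable R : realType.

(** Superlevel sets of a nonincreasing function are intervals. This makes every level function
    [t |-> K {f > t}] measurable, with no measurability asked of [f]. *)
Lemma nonincreasing_emeasurable (D : set R) (f : R -> \bar R) :
  measurable D -> {homo f : x y / (x <= y)%R >-> y <= x} -> measurable_fun D f.
Proof.
move=> mD f_ni; apply: (measurability _ (ErealGenCInfty.measurableE R)) => //.
move=> _ [_ [r ->] <-]; apply: measurableI => //.
apply: is_interval_measurable => s t/=.
rewrite !in_itv/= !andbT => fs ft u /andP[su ut].
by rewrite in_itv/= andbT (le_trans ft)// f_ni.
Qed.

(** The image of Lebesgue measure under the dilation, multiplied by [a], gives []x, y]] the mass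
    [y - x], so it is Lebesgue measure by uniqueness. *)
Lemma ge0_integral_dilation (f : R -> \bar R) (a : R) : (0 < a)%R ->
  (forall t, 0 <= f t) -> measurable_fun setT f ->
  \int[lebesgue_measure]_(t in `]0%R, +oo[) f t =
  a%:E * \int[lebesgue_measure]_(t in `]0%R, +oo[) f (a * t)%R.
Proof.
move=> a0 f0 mf.
have mphi : measurable_fun setT
    (fun t : measurableTypeR R => (a * t)%R : measurableTypeR R).
  exact: measurable_funM.
pose nu_ : {measure set (measurableTypeR R) -> \bar R} :=
  mscale (NngNum (ltW a0)) (pushforward lebesgue_measure
   (fun t : measurableTypeR R => (a * t)%R : measurableTypeR R)).
pose nu := nu_ mphi.
have nuE A : measurable A -> lebesgue_measure A = nu A.
  apply: lebesgue_measure_unique => X [[x y] _ <-].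
  rewrite /nu /nu_ /= /mscale /pushforward /=.
  rewrite [X in _ = _ * lebesgue_measure X](_ : _ = `]x / a, y / a]%classic)%R;
    last first.
    apply/seteqP; split => t /=; rewrite !in_itv /=.
    - by rewrite ltr_pdivrMr// ler_pdivlMr// ![(t * a)%R]mulrC.
    - by rewrite ltr_pdivrMr// ler_pdivlMr// ![(t * a)%R]mulrC.
  rewrite !lebesgue_measure_itv /= !lte_fin ltr_pM2r ?invr_gt0//.
  case: ifPn => _; last by rewrite mule0.
  by rewrite -!EFinD -EFinM; congr EFin; field; rewrite gt_eqF.
have m0 : measurable (`]0%R, +oo[%classic : set R) by exact: measurable_itv.
have mfD : measurable_fun (`]0%R, +oo[%classic : set R) f.
  exact: measurable_funTS.
rewrite (eq_measure_integral nu); last by move=> A mA _; exact: nuE.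
transitivity (a%:E * \int[pushforward lebesgue_measure
    (fun t : measurableTypeR R => (a * t)%R : measurableTypeR R)]_(t in
    `]0%R, +oo[) f t).
  by apply: ge0_integral_mscale => //; exact: mfD.
rewrite (ge0_integral_pushforward mphi)//=.
congr (_ * _); rewrite [X in integral _ X _ = _](_ : _ = `]0%R, +oo[%classic)//.
apply/seteqP; split => t /=; rewrite !in_itv/= !andbT;
  first by rewrite pmulr_rgt0.
exact: mulr_gt0.
Qed.

Lemma measurable_level (T : Type) (K : {outer_measure set T -> \bar R})
    (D : set R) (E : set T) (f : T -> \bar R) : measurable D ->
  measurable_fun D (fun t : R => K [set x | E x /\ t%:E < f x]).
Proof.
move=> mD; apply: nonincreasing_emeasurable => // s t st.
apply: le_outer_measure => x [Ex tx]; split => //.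
by rewrite (le_lt_trans _ tx)// lee_fin.
Qed.

Section outer.
Variables (T : Type) (K : {outer_measure set T -> \bar R}).
Implicit Types (E F : set T) (f g : T -> \bar R).

Lemma choquet_ge0 E f : 0 <= choquet K E f.
Proof. by apply: integral_ge0 => t _; exact: outer_measure_ge0. Qed.

Lemma choquet_eq0 E f : K E = 0 -> choquet K E f = 0.
Proof.
move=> KE; apply: integral0_eq => t _; apply/eqP;
  rewrite eq_le outer_measure_ge0 andbT.
by rewrite -KE le_outer_measure// => x [].
Qed.

Lemma le_choquet_level (K' : {outer_measure set T -> \bar R}) E F f g :
  (forall t : R, (0 < t)%R -> K [set x | E x /\ t%:E < f x] <=
                              K' [set x | F x /\ t%:E < g x]) ->
  choquet K E f <= choquet K' F g.
Proof.
move=> h; apply: ge0_le_integral => //; try exact: measurable_level.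
  by move=> t _; exact: outer_measure_ge0.
by move=> t /=; rewrite in_itv/= andbT => /h.
Qed.

Lemma le_choquet E F f g : E `<=` F -> (forall x, f x <= g x) ->
  choquet K E f <= choquet K F g.
Proof.
move=> EF fg; apply: le_choquet_level => t t0;
  apply: le_outer_measure => x [Ex tx].
by split; [exact: EF|exact: lt_le_trans (fg x)].
Qed.

(** At every level in []0, a[] the superlevel set contains the part of [E] where [f] is at least
    [a]. *)
Lemma choquet_chebyshev E f (a : R) : (0 < a)%R ->
  a%:E * K [set x | E x /\ a%:E <= f x] <= choquet K E f.
Proof.
move=> a0; set k := K _.
have -> : a%:E * k = \int[lebesgue_measure]_(t in `]0%R, a[) k.
  rewrite integral_cst//= lebesgue_measure_itv/= lte_fin a0 oppr0 adde0 muleC//.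
apply: (@le_trans _ _ (\int[lebesgue_measure]_(t in `]0%R, a[)
   K [set x | E x /\ t%:E < f x])).
  apply: ge0_le_integral => //.
  - by move=> t _; exact: outer_measure_ge0.
  - exact: measurable_level.
  move=> t /=; rewrite in_itv/= => /andP[_ ta];
    apply: le_outer_measure => x [Ex ax].
  by split => //; rewrite (lt_le_trans _ ax).
apply: ge0_subset_integral => //.
- exact: measurable_level.
- by move=> t _; exact: outer_measure_ge0.
- by move=> t /=; rewrite !in_itv/= andbT => /andP[].
Qed.

(** Countable subadditivity of [K] holds at each level and is then integrated; it makes the weighted
    content an outer measure. *)
Lemma choquet_bigcup (A : nat -> set T) f :
  choquet K (\bigcup_i A i) f <= \sum_(i <oo) choquet K (A i) f.
Proof.
rewrite -integral_nneseries//; last 2 first.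
- by move=> i; exact: measurable_level.
- by move=> i t _; exact: outer_measure_ge0.
apply: ge0_le_integral => //.
- by move=> t _; exact: outer_measure_ge0.
- exact: measurable_level.
- move=> mD; apply: nonincreasing_emeasurable => // s t st.
  apply: lee_nneseries => [i *|i _]; first exact: outer_measure_ge0.
  apply: le_outer_measure => x [Ex tx]; split => //.
  by rewrite (le_lt_trans _ tx)// lee_fin.
move=> t _; apply: le_trans (outer_measure_sigma_subadditive K _);
  apply: le_outer_measure => x [[i _ Ai] tx].
by exists i.
Qed.

Lemma choquetZ (c : R) E f : (0 < c)%R ->
  choquet K E (fun x => c%:E * f x) = c%:E * choquet K E f.
Proof.
move=> c0; have mK := measurable_level K E (fun x => c%:E * f x) measurableT.
rewrite /choquet (ge0_integral_dilation c0 _ mK); last by move=> t;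
  exact: outer_measure_ge0.
congr (_ * _); apply: eq_integral => t _ /=.
rewrite (_ : [set x | _] = [set x | E x /\ t%:E < f x])//.
by apply/seteqP; split => x /= -[Ex]; rewrite EFinM lte_pmul2l.
Qed.

End outer.

Lemma outer_measure_seq (T : Type) (K : {outer_measure set T -> \bar R})
    (I : eqType) (s : seq I) (F : I -> set T) :
  K [set x | exists2 i, i \in s & F i x] <= \sum_(i <- s) K (F i).
Proof.
elim: s => [|i s IHs].
  rewrite big_nil (_ : [set x | _] = set0) ?outer_measure0//.
  by apply/seteqP; split => // x [].
rewrite big_cons; apply: le_trans (leeD2l _ IHs).
apply: le_trans (outer_measureU2 _ _ _); apply: le_outer_measure.
move=> x [k]; rewrite inE => /orP[/eqP ->|ks] Fx; first by left.
by right; exists k.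
Qed.

Lemma choquet_le_scale (T : Type) (K K' : {outer_measure set T -> \bar R})
    (M : R) E (f : T -> \bar R) : (0 <= M)%R ->
  (forall A, K' A <= M%:E * K A) -> choquet K' E f <= M%:E * choquet K E f.
Proof.
move=> M0 KK'; rewrite /choquet -ge0_integralZl//; last 2 first.
- exact: measurable_level.
- by move=> t _; exact: outer_measure_ge0.
apply: ge0_le_integral => //.
- by move=> t _; exact: outer_measure_ge0.
- exact: measurable_level.
- by apply: measurable_funeM; exact: measurable_level.
Qed.

(** A separate name lets this set function carry an outer measure structure, so that monotonicity
    and countable subadditivity apply to it as they do to [K]. *)
Definition weighted_content (T : Type) (K : set T -> \bar R) (w : T -> \bar R)
  (E : set T) : \bar R := choquet K E w.

Section weighted_content_outer.
Variables (T : Type) (K : {outer_measure set T -> \bar R}) (w : T -> \bar R).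

Let weighted_content0 : weighted_content K w set0 = 0.
Proof. by apply: choquet_eq0; exact: outer_measure0. Qed.

Let weighted_content_ge0 E : 0 <= weighted_content K w E.
Proof. exact: choquet_ge0. Qed.

Let le_weighted_content :
  {homo weighted_content K w : A B / A `<=` B >-> A <= B}.
Proof. by move=> A B AB; apply: le_choquet. Qed.

Let weighted_content_sigma_subadditive :
  sigma_subadditive (weighted_content K w).
Proof. by move=> A; exact: choquet_bigcup. Qed.

HB.instance Definition _ := isOuterMeasure.Build R T (weighted_content K w)
  weighted_content0 weighted_content_ge0 le_weighted_content
  weighted_content_sigma_subadditive.
End weighted_content_outer.

End choquet_theory.

(** * Contents defined by countable covers *)

Section cover_content.
Local Open Scope ereal_scope.
Variables (R : realType) (T C : Type) (c0 : C) (phi : set T -> set T).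
Variables (ok : set C) (S : C -> set T) (cost : C -> R).
Hypothesis phi_le : forall A B, A `<=` B -> phi A `<=` phi B.
Hypothesis cost_ge0 : forall c, (0 <= cost c)%R.

(** Common form of three contents: [phi] is the identity for the Hausdorff and tree contents and the
    interior for the dyadic one; [C] consists of cubes, or of words that address subcubes. *)
Definition cover_content (E : set T) : \bar R :=
  ereal_inf [set s | exists (D : set nat) (Q : nat -> C),
    [/\ forall i, D i -> ok (Q i), E `<=` phi (\bigcup_(i in D) S (Q i)) &
        s = \esum_(i in D) (cost (Q i))%:E]].

Lemma cover_content_le (I : countType) (D : set I) (Q : I -> C) (E : set T) :
  (forall i, D i -> ok (Q i)) -> E `<=` phi (\bigcup_(i in D) S (Q i)) ->
  cover_content E <= \esum_(i in D) (cost (Q i))%:E.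
Proof.
(* [c0] only fills the naturals that encode no index; they lie outside the image of [D]. *)
move=> okQ EQ; pose Q' k := oapp Q c0 (unpickle k : option I).
have Q'E i : Q' (pickle i) = Q i by rewrite /Q' pickleK.
apply: ereal_inf_lbound; exists (pickle @` D), Q'; split.
- by move=> _ [i Di <-]; rewrite Q'E; exact: okQ.
- apply: subset_trans EQ _; apply: phi_le => x [i Di Qx].
  by exists (pickle i); [exists i|rewrite Q'E].
rewrite esum_image; first by apply: eq_esum => i _; rewrite Q'E.
by move=> i j _ _; exact: (pcan_inj pickleK).
Qed.

Lemma cover_content_ge0 E : 0 <= cover_content E.
Proof.
apply/ereal_infP => _ [D [Q [_ _ ->]]].
by apply: esum_ge0 => i _; rewrite lee_fin.
Qed.

Lemma cover_content_set0 : cover_content set0 = 0.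
Proof.
apply/eqP; rewrite eq_le cover_content_ge0 andbT.
rewrite -[leRHS](esum_set0 (fun i : nat => (cost c0)%:E)).
exact: (@cover_content_le nat set0 (fun=> c0)).
Qed.

Lemma le_cover_content : {homo cover_content : A B / A `<=` B >-> A <= B}.
Proof.
move=> A B AB; apply: ereal_inf_le_tmp => _ [D [Q [okQ BQ ->]]].
by exists D, Q; split => //; exact: subset_trans BQ.
Qed.

(** When all contents are finite, covers of the [A i] that are optimal up to [e / 2 ^ i.+1] are
    merged into one cover indexed by pairs. *)
Lemma cover_content_sigma_subadditive : sigma_subadditive cover_content.
Proof.
move=> A; have [[i Ai]|] := pselect (exists i, cover_content (A i) = +oo).
  by rewrite (nneseries_pinfty _ _ Ai) ?leey// => n _; exact: cover_content_ge0.
move=> /forallNP Afin; apply/lee_addgt0Pr => e e0.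
apply: le_trans (epsilon_trick _ _ (ltW e0)); last first.
  by move=> n; exact: cover_content_ge0.
have /choice[DQ DQP] : forall i, exists DQ : set nat * (nat -> C),
    [/\ forall j, DQ.1 j -> ok (DQ.2 j),
     A i `<=` phi (\bigcup_(j in DQ.1) S (DQ.2 j)) &
     \esum_(j in DQ.1) (cost (DQ.2 j))%:E <=
       cover_content (A i) + (e / (2 ^ i.+1)%:R)%:E].
  move=> i; have fA : cover_content (A i) \is a fin_num.
    rewrite ge0_fin_numE ?cover_content_ge0// lt_neqAle leey andbT.
    exact/eqP/Afin.
  have e2 : (0 < e / (2 ^ i.+1)%:R)%R by rewrite divr_gt0// ltr0n expn_gt0.
  have [_ [D [Q [okQ AQ ->]]] /ltW lex] := lb_ereal_inf_adherent e2 fA.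
  by exists (D, Q).
apply: (@le_trans _ _ (\esum_(k in setT `*`` (fun i => (DQ i).1))
    (cost ((DQ k.1).2 k.2))%:E)).
  apply: cover_content_le => [[i j] [_ /= Dj]|].
    by have [+ _ _] := DQP i; exact.
  move=> x [i _ Aix]; have [_ + _] := DQP i => /(_ _ Aix).
  apply: phi_le => y [j Dj Sy].
  by exists (i, j).
rewrite -(esum_esum (a := fun i j => (cost ((DQ i).2 j))%:E)); last first.
  by move=> i j _ _; rewrite lee_fin.
rewrite nneseries_esumT//; last first.
  by move=> n; rewrite adde_ge0 ?cover_content_ge0// lee_fin divr_ge0// ltW.
by apply: le_esum => i _; have [] := DQP i.
Qed.

End cover_content.

Lemma le_esumZl (R : realType) (I : choiceType) (D : set I) (M : R)
    (a : I -> R) : (0 <= M)%R -> (forall i, (0 <= a i)%R) ->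
  (\esum_(i in D) (M * a i)%:E <= M%:E * \esum_(i in D) (a i)%:E)%E.
Proof.
move=> M0 a0; apply: ge_ereal_sup => _ [X [finX XD] <-].
under eq_fsbigr do rewrite EFinM.
rewrite -ge0_mule_fsumr; last by move=> i; rewrite lee_fin.
by rewrite lee_wpmul2l// esum_ge//; exists X.
Qed.

Section domination.
Local Open Scope ereal_scope.
Variables (R : realType) (T C : Type).
Variables (ok : set C) (S : C -> set T) (cost : C -> R).
Hypothesis cost_ge0 : forall c, (0 <= cost c)%R.

(** The hypothesis is summed over a cover. The set [F] localizes the test: it is a cube when
    contents are compared, and the unstopped set when that set is shown to be null. *)
Lemma le_outer_measure_cover_content (K : {outer_measure set T -> \bar R})
    (E F : set T) (M : R) : (0 < M)%R ->
  (forall c, ok c -> K (S c `&` F) <= (M * cost c)%:E) ->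
  K (E `&` F) <= M%:E * cover_content id ok S cost E.
Proof.
move=> M0 h; rewrite -lee_pdivrMl//.
apply/ereal_infP => _ [D [Q [okQ EQ ->]]]; rewrite lee_pdivrMl//.
pose A i := if i \in D then S (Q i) `&` F else set0.
apply: (@le_trans _ _ (K (\bigcup_i A i))).
  apply: le_outer_measure => x [Ex Fx]; have [i Di Sx] := EQ _ Ex.
  by exists i => //; rewrite /A mem_set.
apply: (le_trans (outer_measure_sigma_subadditive K A)).
rewrite nneseries_esumT//; last by move=> i; exact: outer_measure_ge0.
apply: le_trans (le_esumZl _ (ltW M0) _) => //.
rewrite [leRHS]esum_mkcond; apply: le_esum => i _; rewrite /A.
case: ifPn => [/set_mem Di|_]; last by rewrite outer_measure0.
exact/h/okQ.
Qed.
End domination.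

(** * Subcubes and their contents *)

Section cubes.
Variables (R : realType) (n : nat).
Implicit Types (Q P S : cube R n) (b : {ffun 'I_n -> bool}).
Implicit Types (u v : seq {ffun 'I_n -> bool}).

Definition unit_cube : cube R n := Cube 0 ltr01.

Lemma half_edge_gt0 Q : 0 < edge Q / 2.
Proof. by rewrite divr_gt0// edge_gt0. Qed.

Definition half_cube Q b : cube R n :=
  Cube (\row_i (corner Q 0 i + (b i)%:R * (edge Q / 2))) (half_edge_gt0 Q).

(** The dyadic tree below an arbitrary cube, which need not be dyadic itself. A word lists the
    choices of halves, the coarsest first. *)
Fixpoint subcube Q u : cube R n :=
  if u is b :: u' then subcube (half_cube Q b) u' else Q.

Lemma subcube_cat Q u v : subcube Q (u ++ v) = subcube (subcube Q u) v.
Proof. by elim: u Q => //= b u IHu Q; rewrite IHu. Qed.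

Lemma edge_subcube Q u : edge (subcube Q u) = edge Q / 2 ^+ size u.
Proof.
elim: u Q => [|b u IHu] Q /=; first by rewrite expr0 divr1.
by rewrite IHu /= exprS invfM mulrA.
Qed.

Lemma corner_subcube Q u : exists m : 'I_n -> int, forall i,
  corner (subcube Q u) 0 i = corner Q 0 i + edge Q / 2 ^+ size u * (m i)%:~R.
Proof.
elim: u Q => [|b u IHu] Q /=.
  by exists (fun=> 0) => i; rewrite mulr0 addr0.
have [m mE] := IHu (half_cube Q b).
(* Half of the edge of [Q] is [2 ^+ size u] meshes of the final grid. *)
exists (fun i => (b i)%:R * 2 ^+ size u + m i) => i; rewrite mE /= mxE exprS.
have p0 : (2 : R) ^+ size u != 0 by rewrite expf_neq0.
rewrite rmorphD rmorphM rmorphXn /=; case: (b i) => /=; field; exact: p0.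
Qed.

Lemma half_cube_sub Q b : half_cube Q b `<=` Q.
Proof.
move=> x xb i; have := xb i; rewrite /= mxE; have := edge_gt0 Q.
by case: (b i) => /= e0 /andP[h1 h2]; apply/andP; split; lra.
Qed.

Lemma half_cube_inj Q b b' x : cube_set (half_cube Q b) x ->
  cube_set (half_cube Q b') x -> b = b'.
Proof.
move=> xb xb'; apply/ffunP => i; have := xb i; have := xb' i; rewrite /= !mxE.
by case: (b i) (b' i) => -[] /= /andP[h1 h2] /andP[h3 h4] //; exfalso; lra.
Qed.

Lemma half_cube_cover Q x : cube_set Q x ->
  exists b, cube_set (half_cube Q b) x.
Proof.
move=> Qx; exists [ffun i => corner Q 0 i + edge Q / 2 < x 0 i] => i.
have := Qx i; rewrite /= mxE ffunE; have := edge_gt0 Q.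
by case: (ltP (corner Q 0 i + edge Q / 2)) => h /= e0 /andP[h1 h2];
  apply/andP; split; lra.
Qed.

Lemma subcube_sub Q u : subcube Q u `<=` Q.
Proof.
elim: u Q => [|b u IHu] Q //= x /IHu; exact: half_cube_sub.
Qed.

Lemma subcube_cover Q k x : cube_set Q x ->
  exists2 u, size u = k & cube_set (subcube Q u) x.
Proof.
elim: k Q => [|k IHk] Q Qx; first by exists [::].
have [b /IHk[u <- ux]] := half_cube_cover Qx.
by exists (b :: u).
Qed.

Lemma eq_cube Q P : corner Q = corner P -> edge Q = edge P -> Q `<=` P.
Proof. by move=> cQP eQP x Qx i; rewrite -cQP -eQP. Qed.

(* A half-open interval of length at most r meets at most two cells of the
   grid of mesh r. *)
Lemma grid_cell (a r lo x : R) (m : int) : 0 < r ->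
  lo < x <= lo + r -> a + r * m%:~R < x <= a + r * m%:~R + r ->
  m = Num.floor ((lo - a) / r) + (m == Num.floor ((lo - a) / r) + 1)%:R.
Proof.
move=> r0 /andP[lox xlo] /andP[mx xm]; set k := Num.floor _.
have /andP[kl ku] : k%:~R <= (lo - a) / r < (k + 1)%:~R.
  exact: real_floor_itv (num_real _).
rewrite ler_pdivlMr// in kl; rewrite ltr_pdivrMr// rmorphD /= in ku.
have k1 : k < m + 1.
  by rewrite -(ltr_int R) -(ltr_pM2r r0) rmorphD /=; lra.
have k2 : m < k + 2.
  by rewrite -(ltr_int R) -(ltr_pM2r r0) rmorphD /=; lra.
by case: eqP => [->//|]; lia.
Qed.

(** The least [k] that brings [L / 2 ^+ k] below [2 * s] works: one halving less would still be at
    least [2 * s]. *)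
Lemma halving (L s : R) : 0 < L -> 0 < s -> s <= L ->
  exists k, s <= L / 2 ^+ k < 2 * s.
Proof.
move=> L0 s0 sL.
have h : exists k, L / 2 ^+ k < 2 * s.
  exists (Num.truncn (L / s)).
  rewrite ltr_pdivrMr ?exprn_gt0// -ltr_pdivrMl ?mulr_gt0// invfM.
  apply: (@lt_le_trans _ _ (2^-1 * (Num.truncn (L / s)).+1%:R)).
    by rewrite -mulrA ltr_pM2l// mulrC truncnS_gt.
  rewrite ler_pdivrMl// (@le_trans _ _ ((2 ^ Num.truncn (L / s))%:R))//.
    by rewrite ler_nat ltn_expl.
  by rewrite natrX ler_peMl// ?exprn_ge0// ler1n.
case: (ex_minnP h) => -[|j] jlt jmin; first by exists 0;
  rewrite expr0 divr1 in jlt *; rewrite sL.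
exists j.+1; rewrite jlt andbT.
rewrite leNgt; apply/negP => lts;
  suff /jmin : L / 2 ^+ j < 2 * s by rewrite ltnn.
by move: lts; rewrite exprS invfM mulrCA -ltr_pdivrMl// invrK.
Qed.

End cubes.

(** * The Hausdorff, dyadic and tree contents as outer measures *)

Section content_outer_measures.
Local Open Scope ereal_scope.
Variables (R : realType) (n : nat) (delta : R).
Implicit Types (Q P S : cube R n) (A E : set 'rV[R]_n).

Local Notation cost := (fun Q : cube R n => (edge Q `^ delta)%R).

Let cost_ge0 Q : (0 <= cost Q)%R.
Proof. exact: powR_ge0. Qed.

Lemma hausdorff_contentE :
  @hausdorff_content R n delta = cover_content id setT (@cube_set R n) cost.
Proof.
apply/funext => E; congr ereal_inf; apply/seteqP; split => s [D [Q]].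
  by move=> [EQ ->]; exists D, Q.
by move=> [okQ EQ ->]; exists D, Q.
Qed.

Lemma dyadic_contentE : @dyadic_content R n delta =
  cover_content (@interior 'rV[R]_n) (@dyadic R n) (@cube_set R n) cost.
Proof. by []. Qed.

Lemma hausdorff_content_set0 : @hausdorff_content R n delta set0 = 0.
Proof.
by rewrite hausdorff_contentE; apply: (cover_content_set0 (unit_cube R n)).
Qed.

Lemma hausdorff_content_ge0 E : 0 <= hausdorff_content delta E.
Proof. by rewrite hausdorff_contentE; apply: cover_content_ge0. Qed.

Lemma le_hausdorff_content :
  {homo @hausdorff_content R n delta : A B / A `<=` B >-> A <= B}.
Proof. by rewrite hausdorff_contentE; apply: le_cover_content. Qed.

Lemma hausdorff_content_sigma_subadditive :
  sigma_subadditive (@hausdorff_content R n delta).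
Proof.
rewrite hausdorff_contentE.
exact: (cover_content_sigma_subadditive (unit_cube R n)).
Qed.

HB.instance Definition _ :=
  isOuterMeasure.Build R _ (@hausdorff_content R n delta)
  hausdorff_content_set0 hausdorff_content_ge0 le_hausdorff_content
  hausdorff_content_sigma_subadditive.

Lemma dyadic_content_set0 : @dyadic_content R n delta set0 = 0.
Proof.
rewrite dyadic_contentE; apply: (cover_content_set0 (unit_cube R n)) => //.
exact: interiorS.
Qed.

Lemma dyadic_content_ge0 E : 0 <= dyadic_content delta E.
Proof. by rewrite dyadic_contentE; apply: cover_content_ge0. Qed.

Lemma le_dyadic_content :
  {homo @dyadic_content R n delta : A B / A `<=` B >-> A <= B}.
Proof. by rewrite dyadic_contentE; apply: le_cover_content. Qed.

Lemma dyadic_content_sigma_subadditive :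
  sigma_subadditive (@dyadic_content R n delta).
Proof.
rewrite dyadic_contentE.
apply: (cover_content_sigma_subadditive (unit_cube R n)) => //.
exact: interiorS.
Qed.

HB.instance Definition _ := isOuterMeasure.Build R _ (@dyadic_content R n delta)
  dyadic_content_set0 dyadic_content_ge0 le_dyadic_content
  dyadic_content_sigma_subadditive.

(** The dyadic content relative to [Q]: only descendants of [Q] may cover, so a cheap cover splits
    over the children. Intersecting with [Q] makes it an outer measure on the whole space. *)
Definition tree_content Q A : \bar R :=
  cover_content id setT (fun u => cube_set (subcube Q u))
    (fun u => (edge (subcube Q u) `^ delta)%R) (A `&` Q).

Lemma tree_content_set0 Q : tree_content Q set0 = 0.
Proof. by rewrite /tree_content set0I; apply: (cover_content_set0 [::]). Qed.

Lemma tree_content_ge0 Q A : 0 <= tree_content Q A.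
Proof. exact: cover_content_ge0. Qed.

Lemma le_tree_content Q : {homo tree_content Q : A B / A `<=` B >-> A <= B}.
Proof. by move=> A B AB; apply: le_cover_content => //; apply: setSI. Qed.

Lemma tree_content_sigma_subadditive Q : sigma_subadditive (tree_content Q).
Proof.
move=> A; rewrite /tree_content setI_bigcupl.
exact: (cover_content_sigma_subadditive [::]).
Qed.

HB.instance Definition _ Q := isOuterMeasure.Build R _ (tree_content Q)
  (tree_content_set0 Q) (tree_content_ge0 Q) (@le_tree_content Q)
  (@tree_content_sigma_subadditive Q).

Lemma hausdorff_content_cube Q :
  hausdorff_content delta Q <= (edge Q `^ delta)%:E.
Proof.
rewrite hausdorff_contentE -[leRHS](esum_set1 (t := tt)
  (a := fun=> (edge Q `^ delta)%:E))//.
  apply: (cover_content_le Q (phi := id)) => //.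
  by move=> x Qx; exists tt.
by rewrite lee_fin powR_ge0.
Qed.

Lemma tree_content_le Q A : tree_content Q A <= (edge Q `^ delta)%:E.
Proof.
rewrite -[leRHS](esum_set1 (t := tt) (a := fun=> (edge Q `^ delta)%:E))//;
  last first.
  by rewrite lee_fin powR_ge0.
apply: (cover_content_le [::] (phi := id) _ _ (Q := fun=> [::])) => //.
by move=> x [_ Qx]; exists tt.
Qed.

Lemma tree_content_fin_num Q A : tree_content Q A \is a fin_num.
Proof.
rewrite ge0_fin_numE; last exact: outer_measure_ge0.
exact: le_lt_trans (tree_content_le Q A) (ltry _).
Qed.

Lemma tree_contentI Q A : tree_content Q (A `&` Q) = tree_content Q A.
Proof. by rewrite /tree_content -setIA setIid. Qed.

Lemma le_hausdorff_tree_content Q A :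
  hausdorff_content delta (A `&` Q) <= tree_content Q A.
Proof.
rewrite hausdorff_contentE; apply/ereal_infP => _ [D [u [_ Au ->]]].
exact: (cover_content_le (unit_cube R n) (phi := id) _ _
  (Q := fun i => subcube Q (u i))).
Qed.

(** Prefixing [u] to the words of a cover turns descendants of the subcube into descendants of [Q],
    at the same cost. *)
Lemma tree_content_subcube Q u A :
  tree_content Q (A `&` subcube Q u) <= tree_content (subcube Q u) A.
Proof.
apply/ereal_infP => _ [D [v [_ Av ->]]].
under eq_esum do rewrite -subcube_cat.
apply: (cover_content_le [::] (phi := id) _ _ (Q := fun i => u ++ v i)) => //.
move=> x [[Ax ux] _]; have [i Di vx] := Av x (conj Ax ux).
by exists i => //; rewrite subcube_cat.
Qed.

(* A cover cheaper than the cube itself does not use the cube, so it splits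
   into covers of the children. *)
Lemma tree_content_children Q A : tree_content Q A < (edge Q `^ delta)%:E ->
  \sum_(b : {ffun 'I_n -> bool}) tree_content (half_cube Q b) A <=
  tree_content Q A.
Proof.
move=> AQ; rewrite leNgt; apply/negP => AQsum.
have : tree_content Q A < Order.min (edge Q `^ delta)%:E
    (\sum_(b : {ffun 'I_n -> bool}) tree_content (half_cube Q b) A).
  by rewrite lt_min AQ.
move=> /ereal_inf_lt[_ [D [u [_ Au ->]]]]; rewrite lt_min => /andP[uQ].
apply/negP; rewrite -leNgt.
have uN0 i : D i -> u i != [::].
  move=> Di; apply/eqP => ui; move: uQ; apply/negP; rewrite -leNgt.
  apply: esum_ge; exists [set i]; first by split => // _ ->.
  by rewrite fsbig_set1 ui.
(* The first letter of a word names the child that contains its cube, and [a i b] charges the cost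
   to that child. [dflt] is never read on [D], where no word is empty. *)
pose dflt : {ffun 'I_n -> bool} := [ffun=> false].
pose a i b :=
  if head dflt (u i) == b then (edge (subcube Q (u i)) `^ delta)%:E else 0.
have a0 i b : 0 <= a i b by rewrite /a; case: ifP => // _; rewrite lee_fin.
apply: (@le_trans _ _ (\sum_b \esum_(i in D) a i b)); last first.
  rewrite -esum_sum//; apply: le_esum => i Di.
  by rewrite (bigD1 (head dflt (u i)))//= /a eqxx big1 ?adde0// => b /negPf;
    rewrite eq_sym => ->.
apply: lee_sum => b _.
have -> : \esum_(i in D) a i b =
    \esum_(i in D `&` [set i | head dflt (u i) = b])
    (edge (subcube (half_cube Q b) (behead (u i))) `^ delta)%:E.
  rewrite esum_mkcondr; apply: eq_esum => i Di; rewrite /a.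
  have -> : (i \in [set i | head dflt (u i) = b]) = (head dflt (u i) == b).
    by apply/idP/eqP => [/set_mem|?]; [|exact: mem_set].
  by case: eqP => // <-; move: (uN0 i Di); case: (u i).
apply: (cover_content_le [::] (phi := id) _ _
  (Q := fun i => behead (u i))) => //.
move=> x [Ax bx]; have [i Di ux] := Au x (conj Ax (half_cube_sub bx)).
move: (uN0 i Di) ux; case ui : (u i) => [//|b' v] _ /= vx.
have b'b : b' = b by apply: half_cube_inj bx; exact: subcube_sub vx.
by exists i; [split => //=; rewrite ui|rewrite ui /= -b'b].
Qed.

End content_outer_measures.

(** * Comparison of the contents, and their scaling *)

Section comparison.
Local Open Scope ereal_scope.
Variables (R : realType) (n : nat) (delta : R).
Hypothesis delta_ge0 : (0 <= delta)%R.
Implicit Types (Q P S : cube R n) (A E : set 'rV[R]_n).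

Lemma esum_cst_le (T : finType) (D : set T) (c : R) : (0 <= c)%R ->
  \esum_(i in D) c%:E <= (#|T|%:R * c)%:E.
Proof.
move=> c0; rewrite esum_mkcond.
apply: (@le_trans _ _ (\esum_(i in [set: T]) c%:E)).
  by apply: le_esum => i _; case: ifP => //; rewrite lee_fin.
rewrite esum_fset//; last exact: finite_finset.
have -> : [set: T] = [set` enum T] by apply/seteqP; split => x //= _;
  rewrite mem_enum.
by rewrite -fsbig_seq ?enum_uniq// big_enum sumEFin sumr_const mulr_natl.
Qed.

Definition comparison_cst : R := (2 ^+ n * 2 `^ delta)%R.

Lemma comparison_cst_gt0 : (0 < comparison_cst)%R.
Proof. by rewrite mulr_gt0// ?powR_gt0// exprn_gt0. Qed.

Lemma comparison_cst_ge1 : (1 <= comparison_cst)%R.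
Proof.
rewrite /comparison_cst -[leLHS]mul1r ler_pM//.
  by rewrite exprn_ege1// ler1n.
have h2 : (1 <= 2 :> R)%R by rewrite ler1n.
by have := ler_powR h2 delta_ge0; rewrite powRr0.
Qed.

(* [comparison_cst] bounds the cost of [2 ^ n] cells of mesh at most [2 s]. *)
Lemma cell_cost_le (D : set {ffun 'I_n -> bool}) (r s : R) :
  (0 < r < 2 * s)%R ->
  \esum_(i in D) (r `^ delta)%:E <= (comparison_cst * s `^ delta)%:E.
Proof.
move=> /andP[r0 rs]; apply: le_trans (esum_cst_le _ _) _; rewrite ?powR_ge0//.
have s0 : (0 <= s)%R by lra.
rewrite lee_fin card_ffun card_bool card_ord natrX /comparison_cst -mulrA.
rewrite ler_pM2l ?exprn_gt0// -powRM//.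
by apply: ge0_ler_powR => //; rewrite ?nnegrE ?(ltW r0) ?(ltW rs)// mulr_ge0.
Qed.

(** A cube [S] no larger than [Q] meets at most [2 ^ n] subcubes of [Q] of a mesh between [edge S]
    and twice [edge S]. If [S] is larger, [Q] alone is a cheap enough cover. *)
Lemma tree_content_cover_cube Q S :
  tree_content delta Q (cube_set S `&` Q)
    <= (comparison_cst * edge S `^ delta)%:E.
Proof.
have s0 := edge_gt0 S; have e0 := edge_gt0 Q.
have [sQ|Qs] := leP (edge S) (edge Q); last first.
  apply: (le_trans (tree_content_le _ _ _)).
  rewrite lee_fin -[leLHS]mul1r ler_pM ?powR_ge0//.
    exact: comparison_cst_ge1.
  by apply: ge0_ler_powR => //; rewrite ?nnegrE ltW.
have [k /andP[sk k2s]] := halving e0 s0 sQ.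
set r := (edge Q / 2 ^+ k)%R in sk k2s.
have r0 : (0 < r)%R by rewrite divr_gt0// exprn_gt0.
have /choice[m mE] := @corner_subcube R n Q.
pose fl (i : 'I_n) := Num.floor ((corner S 0 i - corner Q 0 i) / r)%R.
(* In each direction a cell that meets [S] has one of two positions, and [pat u] records which.
   Words of length [k] that meet [S] and share a pattern address the same cube, so one
   representative [U s] per pattern suffices. *)
pose pat u : {ffun 'I_n -> bool} := [ffun i => m u i == (fl i + 1)%R].
pose good s u := [/\ size u = k, pat u = s & exists2 x, cube_set S x &
  cube_set (subcube Q u) x].
have /choice[U UP] : forall s, exists u, (exists v, good s v) -> good s u.
  move=> s; have [[v gv]|no] := pselect (exists v, good s v); first by exists v.
  by exists [::].
have goodE u s : good s u -> forall i, m u i = (fl i + (s i)%:R)%R.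
  move=> [uk us [x Sx ux]] i; rewrite -us ffunE;
    apply: (@grid_cell R (corner Q ord0 i) r (corner S ord0 i) (x ord0 i)
      (m u i) r0).
    have /andP[-> xS] /= := Sx i; apply: le_trans xS _.
    by rewrite lerD2l.
  by have := ux i; rewrite mE edge_subcube uk.
have rS : (0 < r < 2 * edge S)%R by rewrite r0 k2s.
apply: le_trans (cell_cost_le [set s | exists v, good s v] rS).
have -> : \esum_(s in [set s | exists v, good s v]) (r `^ delta)%:E =
  \esum_(s in [set s | exists v, good s v]) (edge (subcube Q (U s))
    `^ delta)%:E.
  by apply: eq_esum => s /UP[Uk _ _]; rewrite edge_subcube Uk.
apply: (cover_content_le [::] (phi := id) _ _ (Q := U)) => //.
move=> x [[Sx _] Qx]; have [u uk ux] := subcube_cover k Qx.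
have gu : good (pat u) u by split => //; exists x.
have gU : good (pat u) (U (pat u)) by apply: UP; exists u.
exists (pat u); first by exists u.
apply: eq_cube ux.
  apply/rowP => i; rewrite !mE (goodE _ _ gu) (goodE _ _ gU) uk.
  by case: gU => ->.
by rewrite !edge_subcube uk; case: gU => ->.
Qed.

Lemma tree_content_le_hausdorff Q A :
  tree_content delta Q A <=
  comparison_cst%:E * hausdorff_content delta (A `&` Q).
Proof.
rewrite -tree_contentI -{1}(setIid (cube_set Q)) setIA hausdorff_contentE.
apply: le_outer_measure_cover_content.
- by move=> S; exact: powR_ge0.
- exact: comparison_cst_gt0.
- by move=> S _; exact: tree_content_cover_cube.
Qed.

(** As above with the standard dyadic grid, where [S] must moreover lie in the interior of the union
    of the [2 ^ n] cells. *)
Lemma dyadic_content_cube S :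
  dyadic_content delta (cube_set S) <= (comparison_cst * edge S `^ delta)%:E.
Proof.
have s0 := edge_gt0 S.
have [N sN] : exists N, (edge S <= 2 ^+ N)%R.
  exists (Num.truncn (edge S)).+1; apply: ltW;
    apply: lt_le_trans (truncnS_gt _) _.
  by rewrite -natrX ler_nat ltnW// ltn_expl.
have [k] := halving (exprn_gt0 N (ltr0n R 2)) s0 sN.
set r := (2 ^+ N / 2 ^+ k)%R => /andP[sk k2s].
have r0 : (0 < r)%R by rewrite divr_gt0// exprn_gt0.
have rE : r = (2 ^ (N%:Z - k%:Z))%R by rewrite expfzDr// -invr_expz -!exprnP.
pose fl (i : 'I_n) := Num.floor ((corner S 0 i - 0) / r)%R.
pose cell (s : {ffun 'I_n -> bool}) : cube R n :=
  Cube (\row_i (r * (fl i + (s i)%:R)%:~R)%R) r0.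
have rS : (0 < r < 2 * edge S)%R by rewrite r0 k2s.
apply: le_trans (cell_cost_le setT rS).
rewrite dyadic_contentE; apply: (cover_content_le S _ _ (Q := cell)).
- exact: interiorS.
- move=> s _; exists (N%:Z - k%:Z)%R, (fun i => fl i + (s i)%:R)%R.
  by split => // i; rewrite mxE rE.
(* The cells fill this open box. It contains [S] because cubes are left-open and the upper bound
   given by the floor is strict. *)
pose box : set 'rV[R]_n :=
  [set x | forall i, (r * (fl i)%:~R < x 0 i < r * (fl i)%:~R + 2 * r)%R].
have box_open : open box.
  rewrite openE => x bx; suff : \forall y \near x, box y by [].
  apply: (@filter_forall _ _ (fun i => [set y : 'rV[R]_n |
    r * (fl i)%:~R < y ord0 i < r * (fl i)%:~R + 2 * r]%R) (nbhs x)) => i.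
  apply: (@coord_continuous R 1 n ord0 i x
    [set t | (r * (fl i)%:~R < t < r * (fl i)%:~R + 2 * r)%R]).
  have := @near_in_itvoo R (r * (fl i)%:~R)%R (r * (fl i)%:~R + 2 * r)%R
    (x ord0 i).
  rewrite in_itv /= => /(_ (bx i)); by apply: filterS => t; rewrite in_itv.
have Sbox : cube_set S `<=` box.
  move=> x Sx i; have /andP[Sl Su] := Sx i.
  have /andP := real_floor_itv (num_real ((corner S 0 i - 0) / r)%R).
  rewrite -/(fl i) ler_pdivlMr// ltr_pdivrMr// rmorphD /= => -[h1 h2].
  by apply/andP; split; lra.
apply: subset_trans Sbox _; rewrite -open_subsetE// => x bx.
exists [ffun i => (r * (fl i)%:~R + r < x 0 i)%R] => //.
move=> i; rewrite /= mxE ffunE rmorphD /=; have /andP[h1 h2] := bx i.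
by case: (ltP (r * (fl i)%:~R + r)%R) => h; apply/andP; split => /=; lra.
Qed.

Lemma dyadic_content_le_hausdorff A :
  dyadic_content delta A <= comparison_cst%:E * hausdorff_content delta A.
Proof.
rewrite -{1}(setIT A) hausdorff_contentE.
apply: le_outer_measure_cover_content.
- by move=> S; exact: powR_ge0.
- exact: comparison_cst_gt0.
- by move=> S _; rewrite setIT; exact: dyadic_content_cube.
Qed.

Lemma le_hausdorff_dyadic_content A :
  hausdorff_content delta A <= dyadic_content delta A.
Proof.
apply/ereal_infP => _ [D [Q [dQ AQ ->]]]; apply: ereal_inf_lbound.
by exists D, Q; split => //; exact: subset_trans AQ (@interior_subset _ _).
Qed.

(** The affine map that takes [P] to [Q] takes cubes to cubes and multiplies costs by a constant.
    Exchanging [P] and [Q] yields equality, so contents of cubes are proportional to [l^delta]. *)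
Lemma hausdorff_content_scale Q P :
  hausdorff_content delta Q * (edge P `^ delta)%:E <=
  hausdorff_content delta P * (edge Q `^ delta)%:E.
Proof.
have q0 := edge_gt0 Q; have p0 := edge_gt0 P.
have [a a0 aE] : exists2 a, (0 < a)%R & edge Q = (a * edge P)%R.
  by exists (edge Q / edge P)%R; rewrite ?divr_gt0// mulfVK// gt_eqF.
have ad0 : (0 < a `^ delta)%R by rewrite powR_gt0.
rewrite aE powRM ?(ltW a0) ?(ltW p0)// EFinM muleA.
suff h :
    hausdorff_content delta Q <= hausdorff_content delta P * (a `^ delta)%:E.
  by rewrite lee_wpmul2r// lee_fin powR_ge0.
rewrite muleC -lee_pdivrMl//.
apply/ereal_infP => _ [D [S [PS ->]]]; rewrite lee_pdivrMl//.
(* [g] is the action on cubes of the affine map from [P] to [Q]; below, [y] is the preimage of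
   [x]. *)
pose g (S : cube R n) : cube R n :=
  Cube (corner Q + a *: (corner S - corner P))%R (mulr_gt0 a0 (edge_gt0 S)).
apply: (@le_trans _ _ (\esum_(i in D) (edge (g (S i)) `^ delta)%:E));
  last first.
  apply: le_trans (le_esumZl _ (ltW ad0) _) => [|i]; last exact: powR_ge0.
  by apply: le_esum => i _; rewrite /= powRM ?(ltW a0) ?(ltW (edge_gt0 _)).
rewrite hausdorff_contentE.
apply: (cover_content_le Q (phi := id) _ _ (Q := fun i => g (S i))) => //.
move=> x Qx; pose y : 'rV[R]_n := (corner P + a^-1 *: (x - corner Q))%R.
have yE i : (x ord0 i = corner Q ord0 i + a * (y ord0 i - corner P ord0 i))%R.
  rewrite !mxE; by field; rewrite gt_eqF.
have [|k Dk Sy] := PS y.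
  move=> i; have := Qx i; rewrite yE aE.
  rewrite lerD2l ltrDl pmulr_rgt0// ler_pM2l// => /andP[h1 h2].
  by apply/andP; split; lra.
exists k => // j; rewrite /= !mxE yE; have /andP[h1 h2] := Sy j.
by rewrite ltrD2l ltr_pM2l// -addrA lerD2l -mulrDr ler_pM2l//; apply/andP;
  split; lra.
Qed.

End comparison.

(** * Stopped cubes *)

Section stopping.
Local Open Scope ereal_scope.
Variables (R : realType) (n : nat) (delta theta : R) (E : set 'rV[R]_n).
Hypotheses (theta_gt0 : (0 < theta)%R) (theta_lt1 : (theta < 1)%R).
Implicit Types (P Q : cube R n) (A : set 'rV[R]_n).
Implicit Types (u v : seq {ffun 'I_n -> bool}).

Local Notation h := (tree_content delta).

Definition stopped P := (theta * edge P `^ delta)%:E <= h P E.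

(* The words of length N that lead from P to a maximal stopped subcube. *)
Fixpoint stop_words N P : seq (seq {ffun 'I_n -> bool}) :=
  if `[< stopped P >] then (if N is 0%N then [:: [::]] else [::])
  else if N is N'.+1 then
    flatten [seq [seq b :: u | u <- stop_words N' (half_cube P b)]
            | b <- index_enum {ffun 'I_n -> bool}]
  else [::].

Lemma stop_words0T P : stopped P -> stop_words 0 P = [:: [::]].
Proof. by move=> sP /=; rewrite asboolT. Qed.

Lemma stop_wordsST N P : stopped P -> stop_words N.+1 P = [::].
Proof. by move=> sP /=; rewrite asboolT. Qed.

Lemma stop_words0F P : ~ stopped P -> stop_words 0 P = [::].
Proof. by move=> nP /=; rewrite asboolF. Qed.

Lemma stop_wordsSF N P : ~ stopped P -> stop_words N.+1 P =
  flatten [seq [seq b :: u | u <- stop_words N (half_cube P b)]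
          | b <- index_enum {ffun 'I_n -> bool}].
Proof. by move=> nP /=; rewrite asboolF. Qed.

Lemma mem_stop_wordsSF N P u : ~ stopped P -> u \in stop_words N.+1 P ->
  exists b v, v \in stop_words N (half_cube P b) /\ u = b :: v.
Proof.
by move=> nP; rewrite (stop_wordsSF _ nP) =>
  /flatten_mapP[b _ /mapP[v vb ->]]; exists b, v.
Qed.

Lemma stop_words_stopped N P u : u \in stop_words N P -> stopped (subcube P u).
Proof.
elim: N P u => [|N IHN] P u; have [sP|nP] := pselect (stopped P).
- by rewrite (stop_words0T sP) inE => /eqP ->.
- by rewrite (stop_words0F nP).
- by move=> uP; exfalso; move: uP; rewrite (stop_wordsST _ sP).
- by move=> /(mem_stop_wordsSF nP)[b [v [vb ->]]]; exact: IHN vb.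
Qed.

(** As [P] is not stopped, a word in the list is nonempty, and the cube one generation above its end
    is unstopped by maximality. *)
Lemma stop_words_parent N P u : ~ stopped P -> u \in stop_words N P ->
  exists P' b, ~ stopped P' /\ subcube P u = half_cube P' b.
Proof.
elim: N P u => [|N IHN] P u nP; first by rewrite (stop_words0F nP).
move=> /(mem_stop_wordsSF nP)[b [v [vb ->]]].
have [sb|nb] := pselect (stopped (half_cube P b)); last exact: IHN nb vb.
exists P, b; split; first exact: nP.
case: N {IHN} vb => [|N]; first by rewrite (stop_words0T sb) inE => /eqP ->.
by rewrite (stop_wordsST _ sb).
Qed.

Section sum.
Variable phi : cube R n -> \bar R.

(** Truncating at generation [M] keeps the sums finite and allows induction on [M]. *)
Definition stop_sum M P :=
  \sum_(0 <= N < M) \sum_(u <- stop_words N P) phi (subcube P u).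

Lemma stop_sum0 P : stop_sum 0 P = 0.
Proof. by rewrite /stop_sum big_geq. Qed.

Lemma stop_sum_stopped M P : stopped P -> stop_sum M.+1 P = phi P.
Proof.
move=> sP; rewrite /stop_sum big_nat_recl// (stop_words0T sP)
  big_seq1 big1 ?adde0//.
by move=> N _; rewrite (stop_wordsST _ sP) big_nil.
Qed.

Lemma stop_sumS M P : ~ stopped P ->
  stop_sum M.+1 P = \sum_(b : {ffun 'I_n -> bool}) stop_sum M (half_cube P b).
Proof.
move=> nP; rewrite /stop_sum big_nat_recl// (stop_words0F nP) big_nil add0e.
rewrite [RHS]exchange_big; apply: eq_bigr => N _.
by rewrite (stop_wordsSF _ nP) big_flatten big_map; apply: eq_bigr => b _;
  rewrite big_map.
Qed.

End sum.

Lemma le_stop_sum (phi psi : cube R n -> \bar R) M P :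
  (forall S, stopped S -> phi S <= psi S) ->
    stop_sum phi M P <= stop_sum psi M P.
Proof.
move=> le; rewrite /stop_sum; apply: lee_sum => N _.
by rewrite big_seq [leRHS]big_seq; apply: lee_sum => u /stop_words_stopped/le.
Qed.

(** The content of [E] in an unstopped cube is below [l^delta], hence it dominates the sum over the
    children; a stopped cube is a single term. Induction on the number of generations concludes. *)
Lemma stop_sum_tree_content M P : stop_sum (h^~ E) M P <= h P E.
Proof.
elim: M P => [|M IHM] P; first by rewrite stop_sum0 outer_measure_ge0.
have [sP|nP] := pselect (stopped P); first by rewrite stop_sum_stopped.
rewrite stop_sumS//; apply: le_trans (tree_content_children _); last first.
  move/negP: nP; rewrite -ltNge => /lt_le_trans; apply.
  by rewrite lee_fin ler_piMl// ?powR_ge0// ltW.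
by apply: lee_sum => b _; exact: IHM.
Qed.

(** Each stopped cube satisfies [l^delta <= theta^-1 h(E)], so the packing of the contents of [E]
    bounds the costs. *)
Lemma stop_sum_edge M P :
  stop_sum (fun S => (edge S `^ delta)%:E) M P <=
  (theta^-1 * edge P `^ delta)%:E.
Proof.
have th0 : (0 <= theta^-1)%R by rewrite invr_ge0 ltW.
apply: (@le_trans _ _ (theta^-1%:E * h P E)); last first.
  by rewrite EFinM lee_wpmul2l// tree_content_le.
apply: (@le_trans _ _ (theta^-1%:E * stop_sum (h^~ E) M P)); last first.
  by rewrite lee_wpmul2l// stop_sum_tree_content.
rewrite /stop_sum ge0_sume_distrr; last first.
  by move=> N _; apply: sume_ge0 => u _; exact: outer_measure_ge0.
apply: lee_sum => N _; rewrite ge0_sume_distrr; last first.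
  by move=> u _; exact: outer_measure_ge0.
rewrite big_seq [leRHS]big_seq; apply: lee_sum => u /stop_words_stopped.
by rewrite /stopped EFinM -lee_pdivlMl//.
Qed.

(** Either [A] has full content in [P], and the packing of the costs applies, or its content splits
    over the children and the induction goes on. *)
Lemma stop_sum_packing A M P : stop_sum (h^~ A) M P <= theta^-1%:E * h P A.
Proof.
have th1 : (1 <= theta^-1)%R by rewrite invf_ge1// ltW.
have th0 : (0 <= theta^-1)%R by rewrite invr_ge0 ltW.
elim: M P => [|M IHM] P.
  by rewrite stop_sum0 mule_ge0// outer_measure_ge0.
have [sP|nP] := pselect (stopped P).
  by rewrite stop_sum_stopped// lee_pemull// outer_measure_ge0.
have [PA|AP] := leP (edge P `^ delta)%:E (h P A).
  apply: (@le_trans _ _ (theta^-1%:E * (edge P `^ delta)%:E)); last first.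
    by rewrite lee_wpmul2l.
  rewrite -EFinM; apply: le_trans (stop_sum_edge _ _).
  by apply: le_stop_sum => S _; exact: tree_content_le.
rewrite stop_sumS//; apply: (@le_trans _ _ (theta^-1%:E *
   \sum_(b : {ffun 'I_n -> bool}) h (half_cube P b) A)); last first.
  by rewrite lee_wpmul2l// tree_content_children.
rewrite ge0_sume_distrr; last by move=> b _; exact: outer_measure_ge0.
by apply: lee_sum => b _; exact: IHM.
Qed.

Definition unstopped_part P : set 'rV[R]_n :=
  [set x | [/\ E x, cube_set P x &
    forall N u, u \in stop_words N P -> ~ cube_set (subcube P u) x]].

(** Along [u], a stopped cube has an empty unstopped part. At an unstopped cube the part lies in
    [E], whose content there is below the threshold, or one passes to a child. *)
Lemma tree_content_unstopped_le P u :
  h (subcube P u) (unstopped_part P) <=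
  (theta * edge (subcube P u) `^ delta)%:E.
Proof.
elim: u P => [|b u IHu] P.
all: have [sP|nP] := pselect (stopped P).
- rewrite -tree_contentI (_ : _ `&` _ = set0).
    by rewrite outer_measure0 lee_fin mulr_ge0 ?powR_ge0// ltW.
  apply/seteqP; split => // x [[_ Px stopx] _]; apply: (stopx 0%N [::]) Px.
  by rewrite (stop_words0T sP).
- apply: le_trans (ltW _); last by move/negP: nP; rewrite -ltNge; exact.
  by apply: le_outer_measure => x [].
- rewrite -tree_contentI (_ : _ `&` _ = set0).
    by rewrite outer_measure0 lee_fin mulr_ge0 ?powR_ge0// ltW.
  apply/seteqP; split => // x [[_ Px stopx] _]; apply: (stopx 0%N [::]) Px.
  by rewrite (stop_words0T sP).
- apply: le_trans (IHu (half_cube P b)) => /=.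
  rewrite -tree_contentI; apply: le_outer_measure => x [[Ex Px stopx] ux].
  split => //; first exact: subcube_sub ux.
  move=> N v vb; apply: (stopx N.+1 (b :: v)).
  rewrite (stop_wordsSF _ nP); apply/flatten_mapP; exists b;
    first by rewrite mem_index_enum.
  by apply/mapP; exists v.
Qed.

Lemma tree_content_unstopped P : h P (unstopped_part P) = 0.
Proof.
set Z := unstopped_part P.
have hZ : h P Z <= theta%:E * h P Z.
  (* This splitting lets the domination lemma test [Z] on the cubes of a cover of [Z] itself, which
     gains the factor [theta]. *)
  have {1}-> : Z = (Z `&` P) `&` Z by apply/seteqP; split => [x Zx|x [] []//];
    split => //; split => //; case: Zx.
  apply: (@le_outer_measure_cover_content R _ _ setT
    (fun u => cube_set (subcube P u))
    (fun u => (edge (subcube P u) `^ delta)%R) _ (h P) (Z `&` P) Z theta) => //.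
    by move=> u; exact: powR_ge0.
  move=> u _; apply: le_trans (tree_content_unstopped_le P u).
  by rewrite setIC; exact: tree_content_subcube.
have := tree_content_fin_num delta P Z; have := tree_content_ge0 delta P Z.
case: (h P Z) hZ => [r| |]//; rewrite -EFinM !lee_fin => rr r0 _.
congr EFin; apply/eqP; rewrite eq_le r0 andbT leNgt.
apply/negP => rp; have := ltr_pM2r rp theta 1%R; rewrite theta_lt1 mul1r.
by rewrite ltNge rr.
Qed.

End stopping.

(** * Packing of the weighted content over stopped cubes *)

Section iteration.
Local Open Scope ereal_scope.
Variables (R : realType) (n : nat) (delta : R) (w : 'rV[R]_n -> \bar R).
Hypothesis delta_ge0 : (0 <= delta)%R.
Implicit Types (Q P S : cube R n) (A E : set 'rV[R]_n).

Local Notation H := (@hausdorff_content R n delta).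
Local Notation wH := (weighted_content (@hausdorff_content R n delta) w).
Local Notation M := (comparison_cst n delta).

(** The packing estimate is applied to the superlevel set of [w] at each level and then integrated;
    the return from the tree content to the Hausdorff content costs the comparison constant. *)
Lemma stop_sum_weighted_packing theta E A K P :
  (0 < theta)%R -> (theta < 1)%R ->
  stop_sum delta theta E (fun S => wH (A `&` S)) K P <=
  (M / theta)%:E * wH (A `&` P).
Proof.
move=> t0 t1; have M0 := comparison_cst_gt0 n delta.
have mlevel S (D : set R) : measurable D -> measurable_fun D
    (fun t : R => H [set x | (A `&` S) x /\ t%:E < w x]).
  exact: (measurable_level (@hausdorff_content R n delta)).
have -> : stop_sum delta theta E (fun S => wH (A `&` S)) K P =
  \int[lebesgue_measure]_(t in `]0%R, +oo[) stop_sum delta theta E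
    (fun S => H [set x | (A `&` S) x /\ t%:E < w x]) K P.
  rewrite /stop_sum ge0_integral_sum//.
  - apply: eq_bigr => N _; rewrite ge0_integral_sum//.
    + by move=> u; exact: mlevel.
    + by move=> u t _; exact: outer_measure_ge0.
  - by move=> N; apply: emeasurable_sum => u; exact: mlevel.
  - by move=> N t _; apply: sume_ge0 => u _; exact: outer_measure_ge0.
rewrite /weighted_content /choquet -ge0_integralZl//; last 3 first.
- exact: mlevel.
- by move=> t _; exact: outer_measure_ge0.
- by rewrite lee_fin divr_ge0// ltW.
apply: ge0_le_integral => //.
- move=> t _; apply: sume_ge0 => N _; apply: sume_ge0 => u _.
  exact: outer_measure_ge0.
- by apply: emeasurable_sum => N; apply: emeasurable_sum => u; exact: mlevel.
- by apply: measurable_funeM; exact: mlevel.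
move=> t _; pose At := [set x | A x /\ t%:E < w x].
have AtE S : [set x | (A `&` S) x /\ t%:E < w x] = At `&` S.
  by apply/seteqP; split => x [] [].
have -> : stop_sum delta theta E
   (fun S => H [set x | (A `&` S) x /\ t%:E < w x]) K P =
   stop_sum delta theta E (fun S => H (At `&` S)) K P.
  by apply: eq_bigr => N _; apply: eq_bigr => u _; rewrite AtE.
rewrite AtE; apply: (@le_trans _ _
    (stop_sum delta theta E (fun S => tree_content delta S At) K P)).
  by apply: le_stop_sum => S _; exact: le_hausdorff_tree_content.
apply: le_trans; first exact: stop_sum_packing.
rewrite mulrC EFinM -muleA; apply: lee_wpmul2l.
  by rewrite lee_fin invr_ge0 ltW.
exact: tree_content_le_hausdorff.
Qed.

End iteration.

(** * Weights *)

Section weights.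
Local Open Scope ereal_scope.
Variables (R : realType) (n : nat) (delta : R) (w : 'rV[R]_n -> \bar R).
Hypothesis weight_w : is_weight delta w.
Hypothesis unit_content_gt0 : 0 < hausdorff_content delta (unit_cube R n).
Implicit Types (Q : cube R n) (A : set 'rV[R]_n).

Local Notation H := (hausdorff_content delta).
Local Notation wH A := (choquet (hausdorff_content delta) A w).

Lemma hausdorff_content_cube_ge Q :
  H (unit_cube R n) * (edge Q `^ delta)%:E <= H Q.
Proof.
have := hausdorff_content_scale delta (unit_cube R n) Q.
by rewrite /= powR1 mule1.
Qed.

Lemma hausdorff_content_cube_real Q : exists2 h : R, (0 < h)%R & H Q = h%:E.
Proof.
have Q0 : 0 < H Q.
  apply: lt_le_trans (hausdorff_content_cube_ge Q).
  by rewrite mule_gt0// lte_fin powR_gt0// edge_gt0.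
have : H Q < +oo by exact: le_lt_trans (hausdorff_content_cube _ _) (ltry _).
by move: Q0; case: (H Q) => // h; rewrite lte_fin => h0 _; exists h.
Qed.

Lemma null_exceptional : H [set x | ~ (0 < w x < +oo)] = 0.
Proof. by case: weight_w. Qed.

(** Finiteness is local integrability on the closed cube. If the integral vanished, each set where
    [w] exceeds some [1 / k.+1] would be null by Chebyshev, and so would [Q]. *)
Lemma weight_cube_real Q : exists2 v : R, (0 < v)%R & wH Q = v%:E.
Proof.
have w0 : 0 <= wH Q by exact: choquet_ge0.
have wy : wH Q < +oo.
  pose B : set 'rV[R]_n := [set x | forall i,
    (`[corner Q ord0 i, corner Q ord0 i + edge Q]%classic : set R)%R
      (x ord0 i)].
  have cB : compact B.
    exact: (@rV_compact R n (fun i =>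
      `[corner Q ord0 i, corner Q ord0 i + edge Q]%classic)%R
      (fun i => @segment_compact R _ _)).
  apply: le_lt_trans (weight_w.1 _ cB); apply: le_choquet => [x Qx i|x].
    by rewrite /= in_itv/=; have /andP[/ltW -> ->] := Qx i.
  exact: lee_abs.
have [wQ0|] := eqVneq (wH Q) 0; last first.
  move: w0 wy; case: (wH Q) => // v; rewrite lee_fin => v0 _ vN0.
  by exists v => //; rewrite lt_neqAle v0 andbT eq_sym.
have [h h0 hE] := hausdorff_content_cube_real Q.
have Hpos (a : R) : (0 < a)%R -> H [set x | cube_set Q x /\ a%:E <= w x] = 0.
  move=> a0; apply/eqP; rewrite eq_le outer_measure_ge0 andbT.
  have := choquet_chebyshev (hausdorff_content delta) (cube_set Q) w a0.
  by rewrite wQ0 -lee_pdivlMl// mule0.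
suff : H Q <= 0 by rewrite hE lee_fin leNgt h0.
pose B k := [set x | cube_set Q x /\ (k.+1%:R^-1 : R)%:E <= w x].
apply: (@le_trans _ _ (H ([set x | ~ (0 < w x < +oo)] `|` \bigcup_k B k))).
  apply: le_outer_measure => x Qx.
  have [wx|] := pselect (0 < w x < +oo); last by left.
  right; move: wx => /andP[]; case wE : (w x) => [r| |]//;
    rewrite lte_fin => r0 _.
  exists (Num.truncn r^-1) => //; split => //; rewrite wE lee_fin.
  by rewrite invf_ple ?posrE// ltW// truncnS_gt.
apply: (le_trans (outer_measureU2 _ _ _)); rewrite /= null_exceptional add0e.
apply: (le_trans (outer_measure_sigma_subadditive _ _)).
by rewrite eseries0// => k _ _; apply: Hpos; rewrite invr_gt0.
Qed.

Lemma lty_pos_bound (x : \bar R) : x < +oo ->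
  exists2 k : R, (0 < k)%R & x <= k%:E.
Proof.
case: x => [r _|//|_]; last by exists 1%R; rewrite ?leNye.
by exists (`|r| + 1)%R; rewrite ?ltr_wpDl// lee_fin (le_trans (ler_norm r))//
  lerDl.
Qed.

(* Chebyshev's inequality for the dual weight replaces Hoelder's inequality. *)
Lemma A_class_rarely_small (p : R) : (1 <= p)%R -> A_class p delta w ->
  forall eps : R, (0 < eps)%R -> exists2 tau : R, (0 < tau)%R &
    forall Q (m h : R),
    wH Q = m%:E -> H Q = h%:E ->
    H [set x | cube_set Q x /\ w x < (tau * (m / h))%:E] <= (eps * h)%:E.
Proof.
move=> p1 [_]; case: eqP => [_|/eqP pN1].
  move=> /ereal_inf_lt[_ [c [c0 cM] <-]] _ eps eps0.
  (* For [p = 1], the mean [m / h] is at most the maximal function, hence at most [c * w] outside a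
     null set. *)
  exists c^-1%R; rewrite ?invr_gt0// => Q m h mE hE.
  have [h' h'0] := hausdorff_content_cube_real Q; rewrite hE => -[hh'].
  rewrite -hh' in h'0.
  apply: (@le_trans _ _ 0); last by rewrite lee_fin mulr_ge0// ltW.
  rewrite -cM; apply: le_outer_measure => x [Qx wx] /=; apply/negP;
    rewrite -ltNge.
  apply: (@lt_le_trans _ _ (m / h)%:E).
    case: (w x) wx => [r| |]; rewrite ?lte_fin//.
      by rewrite -ltr_pdivlMl.
    by move=> _; rewrite gt0_muleNy ?lte_fin// ltNyr.
  apply: ereal_sup_ge; exists (choquet_mean delta Q (fun y => `|w y|)).
    by exists Q.
  rewrite /choquet_mean hE inver gt_eqF// EFinM; apply: lee_wpmul2r.
    by rewrite lee_fin invr_ge0 ltW.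
  by rewrite -mE; apply: le_choquet => // y; exact: lee_abs.
have p0 : (0 < p - 1)%R by rewrite subr_gt0 lt_neqAle eq_sym pN1.
move=> /lty_pos_bound[k k0 wk] eps eps0.
set s := ((p - 1)^-1)%R; have s0 : (0 < s)%R by rewrite invr_gt0.
(* [tau] is chosen so that the level [l] of the dual weight [v] on the small set satisfies
   [l * eps = (k / (m / h)) ^ s], the bound on the mean of [v]. *)
exists (eps `^ (p - 1) / k)%R; first by rewrite divr_gt0// powR_gt0.
move=> Q m h mE hE; set tau := (eps `^ (p - 1) / k)%R.
have [h' h0] := hausdorff_content_cube_real Q; rewrite hE => -[hh'].
rewrite -{h'}hh' in h0.
have [m' m0] := weight_cube_real Q; rewrite mE => -[mm'].
rewrite -{m'}mm' in m0.
have tau0 : (0 < tau)%R by rewrite divr_gt0// powR_gt0.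
pose v x := (w x)^-1 `^ s.
have [r r0 [rE rk]] : exists2 r : R, (0 <= r)%R &
    choquet H Q v = r%:E /\ (r / h <= (k / (m / h)) `^ s)%R.
  have := choquet_ge0 (hausdorff_content delta) (cube_set Q) v.
  have : choquet_mean delta Q w * choquet_mean delta Q v `^ (p - 1) <= k%:E.
    by apply: le_trans wk; apply: ereal_sup_ubound; exists Q.
  rewrite /choquet_mean mE hE inver gt_eqF//.
  case: (choquet H Q v) => [r| |]//; last first.
    (* An infinite dual integral would make the product of means infinite. *)
    rewrite gt0_mulye ?lte_fin ?invr_gt0// poweRyr ?gt_eqF// gt0_muley//.
    by rewrite -EFinM lte_fin divr_gt0.
  rewrite -!EFinM !lee_fin => rk r0; exists r => //; split => //.
  have -> : (r / h = ((r / h) `^ (p - 1)) `^ s)%R.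
    by rewrite -powRrM mulfV ?gt_eqF// powRr1// divr_ge0// ltW.
  apply: ge0_ler_powR; rewrite ?nnegrE ?powR_ge0// ?(ltW s0)//.
    by rewrite ltW// divr_gt0// divr_gt0.
  by rewrite ler_pdivlMr ?divr_gt0// mulrC.
set l := ((tau * (m / h))^-1 `^ s)%R.
have l0 : (0 < l)%R by rewrite powR_gt0// invr_gt0 mulr_gt0// divr_gt0.
have lE : (l * eps = (k / (m / h)) `^ s)%R.
  have -> : (k / (m / h) = (tau * (m / h))^-1 * eps `^ (p - 1))%R.
    have e0 : (eps `^ (p - 1) != 0)%R by rewrite gt_eqF// powR_gt0.
    by rewrite /tau; field; rewrite e0 !gt_eqF.
  rewrite powRM ?powR_ge0//; last by rewrite invr_ge0 ltW// mulr_gt0// divr_gt0.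
  by rewrite -powRrM mulfV ?gt_eqF// powRr1// ltW.
apply: (@le_trans _ _ (H ([set x | ~ (0 < w x < +oo)] `|`
    [set x | cube_set Q x /\ l%:E <= v x]))).
  apply: le_outer_measure => x [Qx wx].
  have [wpos|] := pselect (0 < w x < +oo); last by left.
  right; split => //; rewrite /v; move: wpos wx => /andP[].
  case: (w x) => [t| |]//; rewrite lte_fin => t0 _; rewrite lte_fin => tm.
  rewrite inver gt_eqF// poweR_EFin lee_fin.
  apply: ge0_ler_powR; rewrite ?nnegrE ?invr_ge0 ?(ltW p0) ?(ltW t0)//.
    exact: ltW (lt_trans t0 tm).
  by rewrite lef_pV2 ?posrE// ?(ltW tm)// (lt_trans t0).
apply: (le_trans (outer_measureU2 _ _ _)); rewrite /= null_exceptional add0e.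
have := choquet_chebyshev (hausdorff_content delta) (cube_set Q) v l0.
rewrite rE -lee_pdivlMl// => /le_trans; apply; rewrite -EFinM lee_fin.
by rewrite ler_pdivrMl// mulrA lE -ler_pdivrMr.
Qed.

(** With [eps / 2] in the previous lemma, [A] keeps content at least [eps / 2 * h] where
    [w >= tau * (m / h)], and Chebyshev bounds [wH A] from below. *)
Lemma A_class_ample (p : R) : (1 <= p)%R -> A_class p delta w ->
  forall eps : R, (0 < eps)%R -> exists2 C : R, (0 < C)%R & forall Q A,
    A `<=` Q -> eps%:E * H Q <= H A -> wH Q <= C%:E * wH A.
Proof.
move=> p1 wA eps eps0.
have [tau tau0 small] := A_class_rarely_small p1 wA (divr_gt0 eps0 (ltr0n R 2)).
exists (2 / (eps * tau))%R; first by rewrite divr_gt0// mulr_gt0.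
move=> Q A AQ.
have [h h0 hE] := hausdorff_content_cube_real Q.
have [m m0 mE] := weight_cube_real Q.
have a0 : (0 < tau * (m / h))%R by rewrite mulr_gt0// divr_gt0.
rewrite hE mE => epsA.
have : H A <= (tau * (m / h))^-1%:E * wH A + (eps / 2 * h)%:E.
  apply: (@le_trans _ _ (H ([set x | A x /\ (tau * (m / h))%:E <= w x] `|`
      [set x | cube_set Q x /\ w x < (tau * (m / h))%:E]))).
    apply: le_outer_measure => x Ax.
    have [wx|wx] := leP (tau * (m / h))%:E (w x); [left|right] => //.
    by split => //; exact: AQ.
  apply: (le_trans (outer_measureU2 _ _ _)); apply: leeD; last exact: small.
  by rewrite lee_pdivlMl//; exact: choquet_chebyshev.
move=> /(le_trans epsA); have := choquet_ge0 (hausdorff_content delta) A w.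
case: (wH A) => [a| |]//; last by move=> _ _;
  rewrite gt0_muley ?leey// lte_fin divr_gt0// mulr_gt0.
rewrite -!EFinM -EFinD !lee_fin => _ epsh.
have : (eps / 2 * h <= (tau * (m / h))^-1 * a)%R by lra.
rewrite ler_pdivlMl// => le_a.
rewrite mulrAC ler_pdivlMr ?mulr_gt0//.
have -> : (m * (eps * tau) = 2 * (tau * (m / h) * (eps / 2 * h)))%R.
  by field; rewrite gt_eqF.
by rewrite ler_pM2l.
Qed.

End weights.

(** * Exponential decay *)

Section decay.
Local Open Scope ereal_scope.
Variables (R : realType) (n : nat) (delta : R) (w : 'rV[R]_n -> \bar R).
Hypothesis delta_ge0 : (0 <= delta)%R.
Hypothesis weight_w : is_weight delta w.
Hypothesis unit_content_gt0 : 0 < hausdorff_content delta (unit_cube R n).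
Implicit Types (Q P S : cube R n) (A E : set 'rV[R]_n).

Local Notation H := (@hausdorff_content R n delta).
Local Notation wH := (weighted_content (@hausdorff_content R n delta) w).
Local Notation M := (comparison_cst n delta).

Hypothesis ample : forall eps : R, (0 < eps)%R ->
  exists2 C : R, (0 < C)%R & forall Q A,
    A `<=` Q -> eps%:E * H Q <= H A -> wH Q <= C%:E * wH A.

Definition deviation (f : 'rV[R]_n -> R) (c : R) Q (t : R) : set 'rV[R]_n :=
  [set x | cube_set Q x /\ (t < `|f x - c|)%R].

(** [eta] is fixed before [f] and [lam]. The induction on [j] runs over all cubes and centers at
    once, because the step at [Q] uses the bound for [j] on each stopped cube with a center of its
    own. *)
Lemma exponential_decay : exists2 eta : R, (0 < eta)%R &
  forall (f : 'rV[R]_n -> R) (lam : R), (0 <= lam)%R ->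
  (forall Q, exists c, wH (deviation f c Q lam) <= eta%:E * wH Q) ->
  forall j Q c, wH (deviation f c Q lam) <= eta%:E * wH Q ->
    wH (deviation f c Q (2 * j%:R * lam)) <= (2^-1 ^+ j)%:E * wH Q.
Proof.
have M1 := comparison_cst_ge1 n delta_ge0.
have M0 : (0 < M)%R by exact: lt_le_trans M1.
have [k k0 kE] := hausdorff_content_cube_real unit_content_gt0 (unit_cube R n).
have k1 : (k <= 1)%R.
  by have := hausdorff_content_cube delta (unit_cube R n);
    rewrite kE lee_fin powR1.
have d1 : (1 <= 2 `^ delta :> R)%R.
  have h2 : (1 <= 2 :> R)%R by rewrite ler1n.
  by have := ler_powR h2 delta_ge0; rewrite powRr0.
have d0 : (0 < 2 `^ delta :> R)%R by exact: lt_le_trans d1.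
(* With this [theta] an unstopped parent forces [E] to have content below half of [H S] in its child
   [S]: [2 ^ delta] pays for the doubled edge and [k] for the content of the unit cube. *)
pose theta := (k / (2 * 2 `^ delta))%R.
have theta0 : (0 < theta)%R by rewrite divr_gt0// mulr_gt0.
have theta2 : (theta <= 1 / 2)%R.
  by rewrite /theta ler_pdivrMr ?mulr_gt0//; nra.
have theta1 : (theta < 1)%R by lra.
pose eps := (theta / M)%R.
have eps0 : (0 < eps)%R by rewrite divr_gt0.
have eps2 : (eps <= 1 / 2)%R by rewrite /eps ler_pdivrMr//; nra.
have [C C0 ampleC] := ample eps0.
(* The losses are [C] from ampleness and [M / theta] from packing; the extra 2 leaves a gain of one
   half. *)
pose eta := (theta / (2 * M * C))%R.
have eta0 : (0 < eta)%R by rewrite divr_gt0// !mulr_gt0.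
exists eta => // f lam lam0 exadm.
have Hcube Q : exists2 h : R, (0 < h)%R & H Q = h%:E.
  exact: hausdorff_content_cube_real.
have wcube Q : exists2 m : R, (0 < m)%R & wH Q = m%:E.
  exact: weight_cube_real.
(* Otherwise ampleness would give [wH Q <= C * eta * wH Q] with [C * eta = theta / (2 * M) < 1]. *)
have small Q c : wH (deviation f c Q lam) <= eta%:E * wH Q ->
    H (deviation f c Q lam) < eps%:E * H Q.
  move=> dev; rewrite ltNge; apply/negP => /ampleC.
  have dQ : deviation f c Q lam `<=` Q by move=> x [].
  move=> /(_ dQ); have [m m0 mE] := wcube Q.
  rewrite mE in dev *; apply/negP; rewrite -ltNge.
  apply: (@le_lt_trans _ _ (C%:E * (eta%:E * m%:E))).
    by rewrite lee_wpmul2l// lee_fin ltW.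
  rewrite -!EFinM lte_fin /eta.
  have -> : (C * (theta / (2 * M * C) * m) = (theta / (2 * M)) * m)%R.
    by field; rewrite !gt_eqF.
  rewrite gtr_pMl// ltr_pdivrMr ?mulr_gt0//; lra.
elim=> [|j IHj] Q c dev.
  rewrite expr0 mul1e; apply: le_outer_measure => x [].
  by [].
set E := deviation f c Q lam in dev *.
set E' := deviation f c Q _.
have E'E : E' `<=` E.
  move=> x [Qx fx]; split => //; apply: le_lt_trans fx.
  by rewrite -[leLHS]mul1r ler_wpM2r// -natrM ler1n.
have nQ : ~ stopped delta theta E Q.
  apply/negP; rewrite -ltNge.
  apply: (le_lt_trans (tree_content_le_hausdorff delta_ge0 Q E)).
  have [h h0 hE] := Hcube Q.
  have EQ : E `&` Q = E by apply/setIidPl => x [].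
  have := small _ _ dev; rewrite EQ hE -/E -EFinM => EH.
  apply: (@lt_le_trans _ _ (M%:E * (eps * h)%:E)).
    by rewrite lte_pmul2l.
  rewrite -EFinM lee_fin /eps mulrA mulrCA mulfV ?gt_eqF// mulr1 ler_pM2l//.
  by have := hausdorff_content_cube delta Q; rewrite hE lee_fin.
have Q0 : 0 <= (2^-1 ^+ j * C)%:E :> \bar R.
  by rewrite lee_fin mulr_ge0 ?exprn_ge0 ?invr_ge0// ltW.
have stop N u : u \in stop_words delta theta E N Q ->
    wH (E' `&` subcube Q u) <= (2^-1 ^+ j * C)%:E * wH (E `&` subcube Q u).
  move=> uN; set S := subcube Q u.
  have [h h0 hE] := Hcube S.
  have hS : (h <= edge S `^ delta)%R.
    by have := hausdorff_content_cube delta S; rewrite hE lee_fin.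
  have dense : eps%:E * H S <= H (E `&` S).
    have := le_trans (stop_words_stopped uN)
      (tree_content_le_hausdorff delta_ge0 S E).
    rewrite -lee_pdivrMl// => /(le_trans _); apply; rewrite hE -!EFinM lee_fin.
    by rewrite mulrA [(M^-1 * theta)%R]mulrC ler_pM2l.
  have [cS devS] := exadm S.
  (* Less than half of the content of [S] lies in [E], and at most half deviates from [cS], so some
     point of [S] has [f] within [lam] of both centers. *)
  have centers : (`|cS - c| <= 2 * lam)%R.
    have HE : H (E `&` S) < (h / 2)%:E.
      have [P' [b [/negP nP' SP']]] := stop_words_parent nQ uN.
      have -> : S = half_cube P' b by [].
      apply: (@le_lt_trans _ _ (H (E `&` P'))).
        by apply: le_outer_measure; apply: setIS; exact: half_cube_sub.
      apply: (le_lt_trans (le_hausdorff_tree_content _ _ _)).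
      rewrite -ltNge in nP'; apply: (lt_le_trans nP').
      have -> : edge P' = (2 * edge S)%R by rewrite /S SP' /= mulrC divfK.
      rewrite powRM ?(ltW (edge_gt0 _))// lee_fin /theta.
      have -> : (k / (2 * 2 `^ delta) * (2 `^ delta * edge S `^ delta) =
                 k * edge S `^ delta / 2)%R by field; rewrite gt_eqF.
      rewrite ler_pM2r//.
      have := hausdorff_content_cube_ge delta S.
      by rewrite kE hE -EFinM lee_fin.
    have HS : H (deviation f cS S lam) <= (h / 2)%:E.
      apply: le_trans (ltW (small _ _ devS)) _; rewrite hE -EFinM lee_fin.
      nra.
    have [x [Sx xE xS]] : exists x, [/\ cube_set S x, ~ E x &
      ~ deviation f cS S lam x].
      apply: contrapT => /forallNP no.
      have : H S < H S.
        apply: (@le_lt_trans _ _ (H ((E `&` S) `|` deviation f cS S lam))).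
          apply: le_outer_measure => x Sx.
          have [Ex|nEx] := pselect (E x); first by left.
          by right; apply: contrapT => nd; apply: (no x).
        apply: (le_lt_trans (outer_measureU2 _ _ _)).
        rewrite [ltRHS]hE (_ : h = h / 2 + h / 2)%R; last by lra.
        by apply: (le_lt_trans (leeD2l _ HS)); rewrite EFinD; apply: lte_leD.
      by rewrite ltxx.
    have Qx : cube_set Q x by exact: subcube_sub Sx.
    have h1 : (`|f x - c| <= lam)%R by rewrite leNgt; apply/negP => ?;
      exact: xE.
    have h2 : (`|f x - cS| <= lam)%R by rewrite leNgt; apply/negP => ?;
      exact: xS.
    have -> : (cS - c = (f x - c) - (f x - cS))%R by ring.
    by rewrite (le_trans (ler_normB _ _))//; lra.
  apply: (@le_trans _ _ ((2^-1 ^+ j)%:E * wH S)); last first.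
    rewrite EFinM -muleA; apply: lee_wpmul2l.
      by rewrite lee_fin exprn_ge0// invr_ge0.
    by apply: ampleC dense => x [].
  (* The change of center costs [2 * lam], exactly one step of the threshold. *)
  apply: le_trans (IHj S cS devS); apply: le_outer_measure => x [[Qx fx] Sx].
  split => //; have : (`|f x - c| <= `|f x - cS| + `|cS - c|)%R.
    by rewrite (_ : f x - c = (f x - cS) + (cS - c))%R ?ler_normD//; ring.
  move: fx; rewrite -natr1; lra.
pose Z := unstopped_part delta theta E Q.
have wZ : wH Z = 0.
  apply: choquet_eq0; apply/eqP; rewrite eq_le outer_measure_ge0 andbT.
  rewrite -(@tree_content_unstopped R n delta theta E theta0 theta1 Q).
  apply: le_trans (le_hausdorff_tree_content _ _ _).
  by apply: le_outer_measure => x Zx; split => //; case: Zx.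
(* Points of [E'] outside the null set [Z] lie in stopped cubes; [G N] collects those of generation
   [N]. *)
pose G N := [set x | exists2 u, u \in stop_words delta theta E N Q &
                     (E' `&` subcube Q u) x].
apply: (@le_trans _ _ (wH (Z `|` \bigcup_N G N))).
  apply: le_outer_measure => x E'x; have [Zx|nZx] := pselect (Z x);
    first by left.
  right; apply: contrapT => nG; apply: nZx; split; first exact: E'E.
    by case: E'x.
  by move=> N u uN ux; apply: nG; exists N => //; exists u.
apply: (le_trans (outer_measureU2 _ _ _)); rewrite /= wZ add0e.
apply: (le_trans (outer_measure_sigma_subadditive _ _)).
apply: lime_le.
  by apply: is_cvg_nneseries => N _ _; exact: outer_measure_ge0.
apply: nearW => K.
apply: (@le_trans _ _ ((2^-1 ^+ j * C)%:E *
    stop_sum delta theta E (fun S => wH (E `&` S)) K Q)).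
  rewrite /stop_sum ge0_sume_distrr; last first.
    by move=> N _; apply: sume_ge0 => u _; exact: outer_measure_ge0.
  apply: lee_sum => N _; rewrite ge0_sume_distrr; last first.
    by move=> u _; exact: outer_measure_ge0.
  apply: (le_trans (outer_measure_seq _ _ _)).
  by rewrite big_seq [leRHS]big_seq; apply: lee_sum => u; exact: stop.
apply: (@le_trans _ _ ((2^-1 ^+ j * C)%:E * ((M / theta)%:E * wH E))).
  apply: lee_wpmul2l => //; apply: le_trans;
    first exact: stop_sum_weighted_packing.
  apply: lee_wpmul2l; first by rewrite lee_fin divr_ge0// ltW.
  by apply: le_outer_measure => x [].
have [m m0 mE] := wcube Q.
apply: (@le_trans _ _
    ((2^-1 ^+ j * C)%:E * ((M / theta)%:E * (eta%:E * wH Q)))).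
  apply: lee_wpmul2l => //; apply: lee_wpmul2l => //.
  by rewrite lee_fin divr_ge0// ltW.
rewrite mE -!EFinM lee_fin exprS /eta.
rewrite le_eqVlt; apply/orP; left; apply/eqP; field.
by rewrite !gt_eqF.
Qed.

End decay.

(** * Centers and deviation sets of BMO functions *)

Section bmo.
Local Open Scope ereal_scope.
Variables (R : realType) (n : nat) (delta q : R) (w : 'rV[R]_n -> \bar R).
Hypothesis delta_ge0 : (0 <= delta)%R.
Hypothesis q_gt0 : (0 < q)%R.
Hypothesis weight_w : is_weight delta w.
Hypothesis unit_content_gt0 : 0 < hausdorff_content delta (unit_cube R n).
Implicit Types (Q : cube R n) (f : 'rV[R]_n -> R).

Local Notation H := (@hausdorff_content R n delta).
Local Notation wH := (weighted_content (@hausdorff_content R n delta) w).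
Local Notation M := (comparison_cst n delta).
Local Notation pow f c := (weighted_power q w (fun x => f x - c)%R).

Lemma BMO_norm_real f : BMO delta q w f -> BMO_norm delta q w f <> 0 ->
  exists2 N : R, (0 < N)%R & BMO_norm delta q w f = N%:E.
Proof.
move=> [_]; have : 0 <= BMO_norm delta q w f.
  apply: ereal_sup_ge; eexists; first by exists (unit_cube R n).
  by apply/ereal_infP => _ [c _ <-]; exact: poweR_ge0.
case: (BMO_norm delta q w f) => // N; rewrite lee_fin => N0 _ NN0.
exists N => //; rewrite lt_neqAle N0 andbT; apply/eqP => N0'.
by apply: NN0; rewrite -N0'.
Qed.

(** The infimum over centers need not be attained; the factor 2 leaves room for a near-minimizer. *)
Lemma BMO_center f N Q : (0 < N)%R -> BMO_norm delta q w f = N%:E ->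
  exists c, choquet H Q (pow f c) <= ((2 * N) `^ q)%:E * wH Q.
Proof.
move=> N0 fN; have [m m0 mE] := weight_cube_real weight_w unit_content_gt0 Q.
have : ereal_inf (range (fun c : R =>
  oscillation H q w f Q c `^ q^-1)) < (2 * N)%:E.
  apply: (@le_lt_trans _ _ N%:E); last by rewrite lte_fin; lra.
  by rewrite -fN; apply: ereal_sup_ubound; exists Q.
move=> /ereal_inf_lt[_ [c _ <-]]; rewrite /oscillation mE inver gt_eqF// => osc.
exists c; rewrite /weighted_content mE.
have := choquet_ge0 (@hausdorff_content R n delta) (cube_set Q) (pow f c).
move: osc; case: (choquet _ _ _) => [r| |]//; last first.
  by rewrite gt0_mulye ?lte_fin ?invr_gt0// poweRyr// invr_neq0// gt_eqF.
rewrite -EFinM lte_fin => osc; rewrite -EFinM !lee_fin => r0.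
rewrite -ler_pdivrMr//.
have -> : (r / m = ((r / m) `^ q^-1) `^ q)%R.
  by rewrite -powRrM mulVf ?gt_eqF// powRr1// divr_ge0// ltW.
by apply: ge0_ler_powR; rewrite ?nnegrE ?powR_ge0 ?(ltW q_gt0)
  ?(ltW osc)// mulr_ge0// ltW.
Qed.

(** [c] minimizes the dyadic oscillation, so it is compared there with the center of [BMO_center].
    The dyadic weights of [Q] cancel, and the return to the Hausdorff content costs one factor
    [M]. *)
Lemma Gamma_center f N Q c : (0 < N)%R -> BMO_norm delta q w f = N%:E ->
  Gamma delta q w f Q c ->
  choquet H Q (pow f c) <= (M * (2 * N) `^ q)%:E * wH Q.
Proof.
move=> N0 fN gc; have [m m0 mE] := weight_cube_real weight_w unit_content_gt0 Q.
rewrite /weighted_content in mE *.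
have M0 := comparison_cst_gt0 n delta.
have [c' c'P] := BMO_center Q N0 fN.
have dyadicM g : choquet (dyadic_content delta) Q g <= M%:E * choquet H Q g.
  by apply: choquet_le_scale; [exact: ltW|exact: dyadic_content_le_hausdorff].
have dyadicH g : choquet H Q g <= choquet (dyadic_content delta) Q g.
  by apply: le_choquet_level => t _; exact: le_hausdorff_dyadic_content.
have [m' m'0 m'E] : exists2 m' : R, (0 < m')%R &
  choquet (dyadic_content delta) Q w = m'%:E.
  have := dyadicM w; have := dyadicH w; rewrite mE -EFinM.
  case: (choquet _ _ _) => // m'; rewrite lee_fin => mm' _.
  by exists m' => //; exact: lt_le_trans mm'.
have : oscillation (dyadic_content delta) q w f Q c <=
       oscillation (dyadic_content delta) q w f Q c'.
  by rewrite gc; apply: ereal_inf_lbound; exists c'.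
rewrite /oscillation m'E inver gt_eqF// lee_pmul2r ?lte_fin ?invr_gt0// => cc'.
apply: (le_trans (dyadicH _)); apply: (le_trans cc');
  apply: (le_trans (dyadicM _)).
rewrite [X in _ <= X * _]EFinM -[leRHS]muleA; apply: lee_wpmul2l => //.
by rewrite lee_fin ltW.
Qed.

Lemma deviation_chebyshev f c Q (lam : R) : (0 < lam)%R ->
  (lam `^ q)%:E * wH (deviation f c Q lam) <= choquet H Q (pow f c).
Proof.
move=> lam0; have lamq : (0 < lam `^ q)%R by rewrite powR_gt0.
rewrite /weighted_content -(choquetZ (@hausdorff_content R n delta) _ _ lamq).
apply: le_choquet_level => t t0.
apply: le_outer_measure => x [[Qx fx] tx]; split => //.
apply: (lt_le_trans tx).
(* [w] may be negative on a null set, but not where a positive level lies below a positive multiple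
   of it. *)
have [w0|w0] := leP 0 (w x); last first.
  exfalso; move: tx; apply/negP; rewrite -leNgt; apply: (@le_trans _ _ 0).
    by rewrite mule_ge0_le0 ?lee_fin ?powR_ge0// ltW.
  by rewrite lee_fin ltW.
rewrite /weighted_power; apply: lee_wpmul2r => //; rewrite lee_fin.
by apply: ge0_ler_powR; rewrite ?nnegrE ?(ltW q_gt0) ?(ltW lam0) ?(ltW fx)
  ?normr_ge0.
Qed.

End bmo.

Theorem proposition1p11 (R : realType) (n : nat) (delta p q : R)
    (w : 'rV[R]_n -> \bar R) :
  0 < delta <= n%:R -> 1 <= p -> 0 < q -> A_class p delta w ->
  exists c C : R, [/\ 0 < c, 0 < C &
    forall (Q : cube R n) (t : R) (f : 'rV[R]_n -> R) (Cf : R),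
      0 < t -> BMO delta q w f -> BMO_norm delta q w f <> 0%E ->
      Gamma delta q w f Q Cf ->
      (choquet (hausdorff_content delta)
         [set x | cube_set Q x /\ (t < `|f x - Cf|)%R] w
       <= C%:E * choquet (hausdorff_content delta) Q w
          * (expR (- (c * t / fine (BMO_norm delta q w f))))%:E)%E].
Proof.
move=> /andP[/ltW delta0 _] p1 q0 wA; have weight_w := wA.1.
have [unit0|unitN0] := eqVneq (hausdorff_content delta (unit_cube R n)) 0%E.
  exists 1, 1; split => // Q t f Cf _ _ _ _.
  rewrite (_ : choquet _ _ _ = 0%E); last first.
    apply: choquet_eq0; apply/eqP; rewrite eq_le outer_measure_ge0 andbT.
    have := hausdorff_content_scale delta Q (unit_cube R n).
    rewrite /= powR1 mule1 unit0 mul0e; apply: le_trans.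
    by apply: le_outer_measure => x [].
  by rewrite !mule_ge0// ?choquet_ge0// lee_fin expR_ge0.
have unit_gt0 : (0 < hausdorff_content delta (unit_cube R n))%E.
  by rewrite lt_neqAle eq_sym unitN0 outer_measure_ge0.
have [eta eta0 decay] := exponential_decay delta0 weight_w unit_gt0
  (A_class_ample weight_w unit_gt0 p1 wA).
have M1 := comparison_cst_ge1 n delta0.
set M := comparison_cst n delta in M1.
have M0 : 0 < M by exact: lt_le_trans M1.
(* With [lam = N * L], Chebyshev's bound [M * (2 * N) ^ q / lam ^ q] is exactly [eta]. *)
pose L := ((M * 2 `^ q) / eta) `^ q^-1.
have L0 : 0 < L by rewrite powR_gt0// divr_gt0// mulr_gt0// powR_gt0.
(* [c] turns [2 ^ (- t / (2 * lam))] into [exp (- c * t / N)]; [C = 2] pays for rounding the number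
   of steps down. *)
exists (ln 2 / (2 * L)), 2; split => //.
  by rewrite divr_gt0 ?mulr_gt0// ln_gt0// ltr1n.
move=> Q t f Cf t0 fBMO fN0 CfG.
have [N N0 NE] := BMO_norm_real fBMO fN0.
rewrite NE /=; pose lam := N * L.
have lam0 : 0 < lam by rewrite mulr_gt0.
have adm (Q' : cube R n) (c : R) : (choquet (hausdorff_content delta) Q'
      (weighted_power q w (fun x => (f x - c)%R)) <=
      (M * (2 * N) `^ q)%:E *
        weighted_content (hausdorff_content delta) w Q')%E ->
    (weighted_content (hausdorff_content delta) w (deviation f c Q' lam) <=
      eta%:E * weighted_content (hausdorff_content delta) w Q')%E.
  move=> h; have := le_trans (deviation_chebyshev delta w q0 f c Q' lam0) h.
  have lamq : 0 < lam `^ q by rewrite powR_gt0.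
  rewrite -lee_pdivlMl// muleA -EFinM => /le_trans; apply.
  rewrite (_ : (lam `^ q)^-1 * (M * (2 * N) `^ q) = eta)//.
  rewrite /lam !powRM ?(ltW N0) ?(ltW L0)// /L -powRrM mulVf ?gt_eqF// powRr1.
    have q1 : 2 `^ q != 0 by rewrite gt_eqF// powR_gt0.
    have q2 : N `^ q != 0 by rewrite gt_eqF// powR_gt0.
    by field; rewrite q1 q2 !gt_eqF.
  by rewrite divr_ge0 ?mulr_ge0 ?powR_ge0// ltW.
have centers Q' : exists c, (weighted_content (hausdorff_content delta) w
    (deviation f c Q' lam) <=
      eta%:E * weighted_content (hausdorff_content delta) w Q')%E.
  have [c cP] := BMO_center q0 weight_w unit_gt0 Q' N0 NE.
  exists c; apply: adm; apply: le_trans cP _; apply: lee_wpmul2r.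
    exact: outer_measure_ge0.
  by rewrite lee_fin ler_peMl// powR_ge0.
pose j := Num.truncn (t / (2 * lam)).
have ll0 : 0 < 2 * lam by rewrite mulr_gt0.
have jt : 2 * j%:R * lam <= t.
  rewrite mulrAC mulrC -ler_pdivlMr//.
  by rewrite truncn_le divr_ge0// ltW.
have := decay f lam (ltW lam0) centers j Q Cf
  (adm _ _ (Gamma_center delta0 q0 weight_w unit_gt0 N0 NE CfG)).
move=> /(le_trans _) /= h; rewrite muleAC -EFinM.
apply: (@le_trans _ _
    ((2^-1 ^+ j)%:E * weighted_content (hausdorff_content delta) w Q)%E).
  apply: h; apply: le_outer_measure => x [Qx fx]; split => //.
  exact: le_lt_trans fx.
apply: lee_wpmul2r; first exact: choquet_ge0.
rewrite lee_fin.
(* The exponent uses [j.+1], which exceeds [t / (2 * lam)], while [j] itself need not. *)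
have -> : 2^-1 ^+ j = 2 * expR (- (j.+1%:R * ln 2)) :> R.
  by rewrite expRN expRM_natl lnK ?posrE// exprVn exprS invfM mulVKf.
rewrite ler_pM2l// ler_expR lerN2.
have -> : ln 2 / (2 * L) * t / N = t / (2 * lam) * ln 2.
  by rewrite /lam; field; rewrite !gt_eqF.
by rewrite ler_wpM2r ?ln_ge0 ?ler1n// ltW// truncnS_gt.
Qed.
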